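(* Let $p$ be an odd prime and let $G$ be a $5$-generated group of nilpotency class at most $2$ and exponent $p$. Then $G$ is one and only one of the following: (i) nontrivial cyclic; (ii) isomorphic to an amalgamated direct product $G_1\times_{\phi}G_2$ of two nonabelian groups, amalgamating a nontrivial cyclic subgroup of the commutator subgroups; (iii) capable.
   Context: A group is $k$-generated if it can be generated by $k$ elements (it may need fewer). A group $G$ is capable if there exists a group $H$ such that $G\cong H/Z(H)$. Given groups $G_1,G_2$, a subgroup $H\leq Z(G_1)$ and an injective homomorphism $\phi\colon H\to Z(G_2)$, the amalgamated direct product along $\phi$ is $G_1\times_\phi G_2=(G_1\times G_2)/\{(h,\phi(h)^{-1})\mid h\in H\}$. In (ii), ''amalgamating a nontrivial cyclic subgroup of the commutator subgroups'' means that $H$ is a nontrivial cyclic group with $H\subseteq[G_1,G_1]$ and $\phi(H)\subseteq[G_2,G_2]$. *)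

(* Defs.v *)
From HB Require Import structures.
From mathcomp Require Import all_boot.
From mathcomp Require Import boolp classical_sets.

Set Implicit Arguments.
Unset Strict Implicit.
Unset Printing Implicit Defensive.

Local Open Scope classical_set_scope.
Local Open Scope quotient_scope.
Local Open Scope group_scope.

(* Groups are MathComp's [groupType]s, which may be infinite. The carrier must
   be a [choiceType], which under the axioms of [boolp] holds for every type. *)

Section Subgroups.
Variable G : groupType.
Implicit Types (A B : set G) (x y : G).

Definition is_subgroup A : Prop :=
  [/\ A 1, (forall x y, A x -> A y -> A (x * y))
    & (forall x, A x -> A x^-1)].

Definition is_normal A : Prop := forall x y, A x -> A (x ^ y).

Definition gen_subgroup A : set G := smallest is_subgroup A.

Definition group_center : set G := [set x | forall y, commute x y].

Definition comm_subgroup A B : set G :=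
  gen_subgroup [set [~ x, y] | x in A & y in B].

(* Zero-based: [lower_central 0] is G itself (usually written gamma_1). *)
Fixpoint lower_central (n : nat) : set G :=
  if n is m.+1 then comm_subgroup (lower_central m) [set: G] else [set: G].

Definition cyclic_subgroup A : Prop := exists x, A = gen_subgroup [set x].

Definition nontrivial_subgroup A : Prop := exists2 x, A x & x <> 1.

End Subgroups.

Arguments group_center : clear implicits.
Arguments lower_central : clear implicits.

Definition derived_subgroup (G : groupType) : set G :=
  comm_subgroup [set: G] [set: G].
Arguments derived_subgroup : clear implicits.

Definition is_abelian (G : groupType) : Prop := forall x y : G, commute x y.

Definition nil_class_at_most (c : nat) (G : groupType) : Prop :=
  lower_central G c = [set 1].

Definition k_generated (k : nat) (G : groupType) : Prop :=
  exists x : 'I_k -> G, gen_subgroup (range x) = [set: G].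

Definition isomorphic (G H : groupType) : Prop :=
  exists f : {multiplicative G -> H}, bijective f.

Record normal_subgroup (G : groupType) := NormalSubgroup {
  nsub_set : set G;
  nsub_group : is_subgroup nsub_set;
  nsub_normal : is_normal nsub_set
}.

Section Quotient.
Variables (G : groupType) (N : normal_subgroup G).

Definition coset_rel (x y : G) : bool := `[< nsub_set N (x^-1 * y) >].

Lemma coset_rel_refl : reflexive coset_rel.
Proof. by move=> x; apply/asboolP; rewrite mulVg; case: (nsub_group N). Qed.

Lemma coset_rel_sym : symmetric coset_rel.
Proof.
have [_ _ NV] := nsub_group N.
suff imp x y : coset_rel x y -> coset_rel y x by move=> x y; apply/idP/idP; apply: imp.
by move=> /asboolP/NV; rewrite invgM invgK => Nyx; apply/asboolP.
Qed.

Lemma coset_rel_trans : transitive coset_rel.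
Proof.
have [_ NM _] := nsub_group N.
move=> y x z /asboolP Nxy /asboolP Nyz; apply/asboolP.
by have := NM _ _ Nxy Nyz; rewrite mulgA mulgK.
Qed.

Canonical coset_equiv := EquivRel coset_rel coset_rel_refl coset_rel_sym coset_rel_trans.

Definition factor_group := {eq_quot coset_equiv}.
HB.instance Definition _ := Choice.on factor_group.
HB.instance Definition _ := EqQuotient.on factor_group.

Definition quo_one : factor_group := \pi_factor_group 1.
Definition quo_inv (a : factor_group) : factor_group := \pi_factor_group ((repr a)^-1).
Definition quo_mul (a b : factor_group) : factor_group :=
  \pi_factor_group (repr a * repr b).

Lemma quo_eqP (x y : G) :
  nsub_set N (x^-1 * y) <-> \pi_factor_group x = \pi_factor_group y.
Proof.
split=> [Nxy|]; first by apply/eqquotP/asboolP.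
by move/eqquotP/asboolP.
Qed.

Lemma quo_mulE (x y : G) :
  quo_mul (\pi_factor_group x) (\pi_factor_group y) = \pi_factor_group (x * y).
Proof.
rewrite /quo_mul; apply/quo_eqP.
have [_ NM _] := nsub_group N.
have /quo_eqP := reprK (\pi_factor_group x).
have /quo_eqP := reprK (\pi_factor_group y).
set y' := repr _; set x' := repr _ => Ny Nx.
have := NM _ _ (nsub_normal y' Nx) Ny.
by rewrite /conjg -!mulgA mulVKg invgM -!mulgA.
Qed.

Lemma quo_invE (x : G) : quo_inv (\pi_factor_group x) = \pi_factor_group (x^-1).
Proof.
rewrite /quo_inv; apply/quo_eqP.
have [_ _ NV] := nsub_group N.
have /quo_eqP := reprK (\pi_factor_group x).
set x' := repr _ => /NV /(nsub_normal x'^-1).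
by rewrite /conjg invgM !invgK -!mulgA mulgV mulg1; apply.
Qed.

Lemma quo_mulA : associative quo_mul.
Proof.
move=> a b c; rewrite -(reprK a) -(reprK b) -(reprK c).
move: (repr a) (repr b) (repr c) => x y z.
by rewrite (quo_mulE y z) (quo_mulE x y) !quo_mulE mulgA.
Qed.

Lemma quo_mul1g : left_id quo_one quo_mul.
Proof.
by move=> a; rewrite -(reprK a); move: (repr a) => x; rewrite quo_mulE mul1g.
Qed.

Lemma quo_mulg1 : right_id quo_one quo_mul.
Proof.
by move=> a; rewrite -(reprK a); move: (repr a) => x; rewrite quo_mulE mulg1.
Qed.

Lemma quo_mulVg : left_inverse quo_one quo_inv quo_mul.
Proof.
move=> a; rewrite -(reprK a); move: (repr a) => x.
by rewrite quo_invE quo_mulE mulVg.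
Qed.

Lemma quo_mulgV : right_inverse quo_one quo_inv quo_mul.
Proof.
move=> a; rewrite -(reprK a); move: (repr a) => x.
by rewrite quo_invE quo_mulE mulgV.
Qed.

HB.instance Definition _ :=
  isGroup.Build factor_group
    quo_mulA quo_mul1g quo_mulg1 quo_mulVg quo_mulgV.

End Quotient.

Section Center.
Variable G : groupType.

Lemma center_is_subgroup : is_subgroup (group_center G).
Proof.
split=> [y|x y Zx Zy z|x Zx y]; first exact/commute_sym/commute1.
  by apply/commute_sym/commuteM; apply/commute_sym.
exact/commute_sym/commuteV/commute_sym.
Qed.

Lemma center_is_normal : is_normal (group_center G).
Proof. by move=> x y Zx; rewrite /conjg (Zx y) mulKg. Qed.

Definition center_subgroup : normal_subgroup G :=
  NormalSubgroup center_is_subgroup center_is_normal.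

End Center.

Definition capable (G : groupType) : Prop :=
  exists H : groupType, isomorphic G (factor_group (center_subgroup H)).

(* The map [amalg_map] matters only on the amalgamated subgroup [amalg_dom];
   its values elsewhere are irrelevant. *)
Record amalgamation (G1 G2 : groupType) := Amalgamation {
  amalg_dom : set G1;
  amalg_map : G1 -> G2;
  amalg_dom_group : is_subgroup amalg_dom;
  amalg_dom_center : amalg_dom `<=` group_center G1;
  amalg_map_center : amalg_map @` amalg_dom `<=` group_center G2;
  amalg_mapM : {in amalg_dom &, {morph amalg_map : x y / x * y}};
  amalg_map_inj : {in amalg_dom &, injective amalg_map}
}.

Section AmalgamatedProduct.
Variables (G1 G2 : groupType) (phi : amalgamation G1 G2).

Definition amalg_kernel_set : set (G1 * G2)%type :=
  [set (h, (amalg_map phi h)^-1) | h in amalg_dom phi].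

Lemma amalg_kernel_is_subgroup : is_subgroup amalg_kernel_set.
Proof.
have [H1 HM HV] := amalg_dom_group phi.
have morphM x y : amalg_dom phi x -> amalg_dom phi y ->
    amalg_map phi (x * y) = amalg_map phi x * amalg_map phi y.
  by move=> Hx Hy; apply: amalg_mapM; rewrite inE.
have morph1 : amalg_map phi 1 = 1.
  by apply: (@mulgI _ (amalg_map phi 1)); rewrite -morphM// !mulg1.
split.
- by exists 1 => //; rewrite morph1 invg1.
- move=> _ _ [x Hx <-] [y Hy <-]; exists (x * y); first exact: HM.
  congr (_, _); rewrite morphM// invgM.
  apply/commuteV/commute_sym/commuteV.
  by apply: (amalg_map_center (a := phi)); exists x.
- move=> _ [x Hx <-]; exists x^-1; first exact: HV.
  congr (_, _); congr (_^-1).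
  apply: (@mulgI _ (amalg_map phi x)).
  by rewrite -morphM ?mulgV ?morph1//; apply: HV.
Qed.

Lemma amalg_kernel_is_normal : is_normal amalg_kernel_set.
Proof.
move=> _ [y1 y2] [x Hx <-]; exists x => //.
have Zx : commute x y1 by exact: (amalg_dom_center Hx).
have Zy : commute (amalg_map phi x) y2.
  by apply: (amalg_map_center (a := phi)); exists x.
have {}Zy : commute (amalg_map phi x)^-1 y2.
  exact/commute_sym/commuteV/commute_sym.
by congr (_, _); rewrite /= ?Zx ?Zy mulKg.
Qed.

Definition amalg_kernel : normal_subgroup (G1 * G2)%type :=
  NormalSubgroup amalg_kernel_is_subgroup amalg_kernel_is_normal.

Definition amalgamated_product : groupType := factor_group amalg_kernel.

End AmalgamatedProduct.

Definition nontrivial_cyclic (G : groupType) : Prop :=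
  cyclic_subgroup [set: G] /\ nontrivial_subgroup [set: G].

Definition nonabelian_amalgam (G : groupType) : Prop :=
  exists (G1 G2 : groupType) (phi : amalgamation G1 G2),
    [/\ ~ is_abelian G1 /\ ~ is_abelian G2,
        cyclic_subgroup (amalg_dom phi) /\ nontrivial_subgroup (amalg_dom phi),
        amalg_dom phi `<=` derived_subgroup G1,
        amalg_map phi @` amalg_dom phi `<=` derived_subgroup G2
      & isomorphic G (amalgamated_product phi)].

Definition exactly_one3 (P Q R : Prop) : Prop :=
  [\/ [/\ P, ~ Q & ~ R], [/\ ~ P, Q & ~ R] | [/\ ~ P, ~ Q & R]].

(* Main.v *)
Require Import Defs.
From HB Require Import structures.
From mathcomp Require Import all_boot all_algebra ring.
From mathcomp Require Import boolp classical_sets functions.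

(* Let V = F_p^n with n minimal, and let c : V x V -> G' be the commutator form.
   A bilinear t : G' x V -> F_p with the Jacobi property
   t(c(x,y),u) + t(c(y,u),x) + t(c(u,x),y) = 0 yields a 2-cocycle f of G with
   f(z,g) - f(g,z) = t(z,g), so if t(z,-) <> 0 then z does not lift to a central
   element of the extension defined by f; a family of cocycles that detects every
   z <> 1 makes G capable. If all these t kill some z <> 0 and n <= 5, then there
   are a, b with c(a,b) = z and c(a,V), c(b,V) contained in <z>, so that G is the
   central product of <a,b> and its centraliser. Otherwise one can
   write down a t with t(z,-) <> 0, as follows. If a form xi o c with xi(z) = 0 has rank 4, then
   V is a symplectic 4-space plus at most a line, and t combines xi with one further
   functional. If all these forms have rank at most 2, then c modulo z either has an
   isotropic hyperplane or is the full exterior square on a 3-dimensional quotient of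
   V, and the radical of c mod z is c-isotropic by assumption.
   Conversely an amalgam is not capable by the three subgroups lemma: a lift of an
   element of G_1' and G_2' to H centralises the lifts of both factors. *)

Set Implicit Arguments.
Unset Strict Implicit.
Unset Printing Implicit Defensive.
Import GRing.Theory.

(** * Linear algebra of alternating bilinear maps *)

Lemma eq_sub2 (R : pzRingType) (a b d e u v : R) :
  a = b -> d = e -> (u - v = (a - b) - (d - e))%R -> u = v.
Proof. by move=> -> ->; rewrite !subrr => /eqP; rewrite subr_eq0 => /eqP. Qed.

Section JacobiForms.
Local Open Scope ring_scope.
Variables (F : fieldType) (V L : vectType F) (c : V -> V -> L).

Definition jacobi_form (t : L -> V -> F) : Prop :=
  [/\ forall w, scalar (t w), forall v, scalar (t^~ v)
    & forall x y u, t (c x y) u + t (c y u) x + t (c u x) y = 0].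

Lemma scalarP_ex (U : vectType F) (f : U -> F) :
  scalar f -> exists g : {scalar U}, f =1 g.
Proof.
by move=> lf; exists (HB.pack_for {scalar U} f (GRing.isLinear.Build F U F *%R f lf)).
Qed.

Lemma hom_ex (U W : vectType F) (f : U -> W) :
  linear f -> exists g : 'Hom(U, W), f =1 g.
Proof.
move=> lf; pose f' := HB.pack_for {linear U -> W} f (GRing.isLinear.Build F U W *:%R f lf).
by exists (linfun f') => u; rewrite lfunE.
Qed.

Lemma linear_partial_inverse (U W : vectType F) (f : U -> W) :
  linear f -> exists g : 'Hom(W, U), forall u, f (g (f u)) = f u.
Proof.
move=> /hom_ex[h fh]; exists (h^-1)%VF => u.
by rewrite !fh limg_lfunVK// memv_img// memvf.
Qed.

Lemma scalar_add (U : vectType F) (f : {scalar U}) x y : f (x + y) = f x + f y.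
Proof. exact: linearD. Qed.
Lemma scalar_scale (U : vectType F) (f : {scalar U}) a x : f (a *: x) = a * f x.
Proof. exact: linearZ. Qed.
Lemma scalar_opp (U : vectType F) (f : {scalar U}) x : f (- x) = - f x.
Proof. exact: linearN. Qed.
Definition scE := (scalar_add, scalar_scale, scalar_opp).

Lemma separating_scalar (W : vectType F) (U : {vspace W}) z :
  z \notin U -> exists f : {scalar W}, f z = 1 /\ (forall u, u \in U -> f u = 0).
Proof.
move=> zU; pose q := projv U.
pose b := vbasis {:W}.
(* The component of [z] off [U] is nonzero, so one of its coordinates is; that coordinate, rescaled,
   is the functional. *)
have [i ci] : exists i, coord b i (z - q z) != 0.
  apply/existsP; rewrite -[[exists _, _]]negbK; apply/negP => /existsPn ci; case/negP: zU.
  have : z - q z = 0.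
    rewrite (coord_vbasis (memvf (z - q z))) big1// => i _.
    by move/negPn/eqP: (ci i) => ->; rewrite scale0r.
  by move/eqP; rewrite subr_eq0 => /eqP ->; rewrite memv_proj.
have lf : scalar (fun w => coord b i (w - q w) / coord b i (z - q z)).
  move=> a u v; rewrite linearP/= opprD addrACA -scalerBr linearP/=.
  by rewrite mulrDl mulrA.
have [f fE] := scalarP_ex lf.
exists f; split=> [|u uU]; rewrite -fE ?divff//.
by rewrite projv_id// subrr linear0 mul0r.
Qed.

Hypotheses (cl : forall x, linear (c x)) (cr : forall y, linear (c^~ y)).
Hypothesis calt : forall x, c x x = 0.

Lemma brD1 x y u : c (x + y) u = c x u + c y u.
Proof. by have := cr u 1 x y; rewrite !scale1r. Qed.
Lemma brD2 u x y : c u (x + y) = c u x + c u y.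
Proof. by have := cl u 1 x y; rewrite !scale1r. Qed.
Lemma br01 u : c 0 u = 0.
Proof. by have := cr u (-1) 0 0; rewrite scaleN1r addNr scaleN1r addNr. Qed.
Lemma br02 u : c u 0 = 0.
Proof. by have := cl u (-1) 0 0; rewrite scaleN1r addNr scaleN1r addNr. Qed.
Lemma brZ1 a x u : c (a *: x) u = a *: c x u.
Proof. by have := cr u a x 0; rewrite br01 !addr0. Qed.
Lemma brZ2 a u x : c u (a *: x) = a *: c u x.
Proof. by have := cl u a x 0; rewrite br02 !addr0. Qed.
Lemma brC x y : c y x = - c x y.
Proof.
apply/eqP; rewrite -addr_eq0 addrC; apply/eqP; move: (calt (x + y)).
by rewrite brD1 !brD2 !calt addr0 add0r.
Qed.
Definition brE := (brD1, brD2, brZ1, brZ2).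

Lemma scalar_brC (f : {scalar L}) x y : f (c y x) = - f (c x y).
Proof. by rewrite brC scalar_opp. Qed.
Lemma scalar_brl (f : {scalar L}) y : scalar (fun x => f (c x y)).
Proof. by move=> a u v; rewrite !brE !scE. Qed.
Lemma scalar_brr (f : {scalar L}) x : scalar (fun y => f (c x y)).
Proof. by move=> a u v; rewrite !brE !scE. Qed.

(** * Forms of rank 4: a symplectic 4-space plus at most a line *)

Section Symplectic.
Variables (z : L) (xi : {scalar L}) (x1 y1 x2 y2 : V).
Hypotheses (z_neq0 : z != 0) (xiz : xi z = 0).
Hypotheses (xy1 : xi (c x1 y1) = 1) (xy2 : xi (c x2 y2) = 1)
  (xx : xi (c x1 x2) = 0) (xy : xi (c x1 y2) = 0)
  (yx : xi (c y1 x2) = 0) (yy : xi (c y1 y2) = 0).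

(** Coordinates along [x1], [y1], [x2], [y2], each read off by pairing with the dual vector under
    [xi] o [c]. *)
Let f1 v := xi (c v y1).
Let f2 v := xi (c x1 v).
Let f3 v := xi (c v y2).
Let f4 v := xi (c x2 v).

(** The orthogonal complement of the 4-space is the kernel of the surjection ([f1], [f2], [f3],
    [f4]), hence of dimension at most 1. In dimension 4 both [e] and [h] are 0. *)
Lemma symplectic_complement : (\dim {:V} <= 5)%N ->
  exists (e : V) (h : {scalar V}),
    [/\ f1 e = 0, f2 e = 0, f3 e = 0, f4 e = 0
      & forall v, v = f1 v *: x1 + f2 v *: y1 + f3 v *: x2 + f4 v *: y2 + h v *: e].
Proof.
move=> dV.
have lf1 : scalar f1 by exact: scalar_brl.
have lf2 : scalar f2 by exact: scalar_brr.
have lf3 : scalar f3 by exact: scalar_brl.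
have lf4 : scalar f4 by exact: scalar_brr.
pose phi v : 'rV[F]_4 := \row_i [:: f1 v; f2 v; f3 v; f4 v]`_i.
have lphi : linear phi.
  move=> a u v; apply/rowP => i; rewrite !mxE.
  by case: i => -[|[|[|[|]]]]//= _; rewrite ?lf1 ?lf2 ?lf3 ?lf4.
have [Phi phiE] := hom_ex lphi.
pose rho v := v - (f1 v *: x1 + f2 v *: y1 + f3 v *: x2 + f4 v *: y2).
have coordsE r1 r2 r3 r4 : let v := r1 *: x1 + r2 *: y1 + r3 *: x2 + r4 *: y2 in
    [/\ f1 v = r1, f2 v = r2, f3 v = r3 & f4 v = r4].
  rewrite /= /f1 /f2 /f3 /f4 !brE !scE !calt linear0 xy1 xy2 xx xy yy.
  rewrite (scalar_brC xi y1 x2) (scalar_brC xi y1 y2) (scalar_brC xi x1 x2) xx yx yy.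
  split; ring.
have rhoP v : [/\ f1 (rho v) = 0, f2 (rho v) = 0, f3 (rho v) = 0 & f4 (rho v) = 0].
  have [] := coordsE (f1 v) (f2 v) (f3 v) (f4 v); rewrite /rho /=; set u := _ + _ => e1 e2 e3 e4.
  have -> : v - u = (-1) *: u + v by rewrite scaleN1r addrC.
  by rewrite lf1 lf2 lf3 lf4 e1 e2 e3 e4; split; ring.
have PhiE v : Phi v = phi v by rewrite phiE.
have dker : (\dim (lker Phi) <= 1)%N.
  have := limg_ker_dim Phi fullv; rewrite capfv.
  have -> : limg Phi = fullv.
    apply/vspaceP => r; rewrite memvf; apply/memv_imgP.
    exists (r 0 0 *: x1 + r 0 1 *: y1 + r 0 2%:R *: x2 + r 0 3%:R *: y2); first exact: memvf.
    rewrite PhiE; have [e1 e2 e3 e4] := coordsE (r 0 0) (r 0 1) (r 0 2%:R) (r 0 3%:R).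
    apply/rowP => i; rewrite mxE e1 e2 e3 e4.
    by case: i => -[|[|[|[|]]]]//= lt; congr (r _ _); apply/val_inj.
  rewrite dimvf /= => e; have : (\dim (lker Phi) + 4 <= 1 + 4)%N by rewrite [X in (X <= _)%N]e; exact: dV.
  by rewrite leq_add2r.
have rhoK v : rho v \in lker Phi.
  rewrite memv_ker PhiE; apply/eqP/rowP => i; rewrite !mxE.
  have [-> -> -> ->] := rhoP v.
  by case: i => -[|[|[|[|]]]].
pose e := vpick (lker Phi).
have eK : e \in lker Phi by exact: memv_pick.
have fe : [/\ f1 e = 0, f2 e = 0, f3 e = 0 & f4 e = 0].
  move: eK; rewrite memv_ker PhiE => /eqP/rowP fe.
  by have := fe 0; have := fe 1; have := fe 2%:R; have := fe 3%:R; rewrite !mxE.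
have eline v : exists k, rho v = k *: e.
  suff /vlineP[k ->] : rho v \in <[e]>%VS by exists k.
  suff <- : lker Phi = <[e]>%VS by exact: rhoK.
  apply/esym/eqP; rewrite eqEdim -memvE eK /= dim_vline.
  by rewrite vpick0 -dimv_eq0; case: (\dim _) dker => [|[]].
have [eta etaE] : exists eta : {scalar V}, forall k, eta (k *: e) *: e = k *: e.
  have [e0|e_neq0] := eqVneq e 0.
    have [|eta _] := @scalarP_ex V (fun=> 0); first by move=> a u v; rewrite mulr0 addr0.
    by exists eta => k; rewrite e0 !scaler0.
  have [|eta [eta1 _]] := @separating_scalar _ 0%VS e; first by rewrite memv0.
  by exists eta => k; rewrite linearZ/= eta1 mulr1.
have [h hE] : exists h : {scalar V}, (fun v => eta (rho v)) =1 h.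
  apply: scalarP_ex => a u v.
  by rewrite /rho !lf1 !lf2 !lf3 !lf4 !scE; ring.
exists e, h; case: fe => *; split=> // v; have [k rk] := eline v.
by rewrite -hE rk etaE -rk addrC subrK.
Qed.

(** With [om] = [eta] o [c], the Jacobi identity for [eta] tensor [t1] plus [xi] tensor [t0] says
    that the 3-form om /\ t1 + (xi o c) /\ t0 vanishes. Its part involving [h] is h /\ b /\ t1,
    which forces [t1] to be proportional to [b]; the rest lives on the 4-space and is cancelled by
    [t0]. *)
Lemma symplectic_jacobi : (\dim {:V} <= 5)%N ->
  exists2 t, jacobi_form t & exists v, t z v <> 0.
Proof.
move=> dV; have [e [h [e1 e2 e3 e4 dec]]] := symplectic_complement dV.
have lf1 : scalar f1 by exact: scalar_brl.
have lf2 : scalar f2 by exact: scalar_brr.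
have lf3 : scalar f3 by exact: scalar_brl.
have lf4 : scalar f4 by exact: scalar_brr.
have [|eta [etaz _]] := @separating_scalar _ 0%VS z; first by rewrite memv0.
pose om u v := eta (c u v).
pose b1 := om e x1; pose b2 := om e y1; pose b3 := om e x2; pose b4 := om e y2.
have omE u v : om u v =
  om x1 y1 * (f1 u * f2 v - f2 u * f1 v) + om x1 x2 * (f1 u * f3 v - f3 u * f1 v) +
  om x1 y2 * (f1 u * f4 v - f4 u * f1 v) + om y1 x2 * (f2 u * f3 v - f3 u * f2 v) +
  om y1 y2 * (f2 u * f4 v - f4 u * f2 v) + om x2 y2 * (f3 u * f4 v - f4 u * f3 v) +
  h u * (b1 * f1 v + b2 * f2 v + b3 * f3 v + b4 * f4 v) -
  h v * (b1 * f1 u + b2 * f2 u + b3 * f3 u + b4 * f4 u).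
  rewrite {1}/om {1}(dec u) {1}(dec v) !brE !scE !calt linear0.
  rewrite (scalar_brC _ x1 y1) (scalar_brC _ x1 x2) (scalar_brC _ x1 y2).
  rewrite (scalar_brC _ y1 x2) (scalar_brC _ y1 y2) (scalar_brC _ x2 y2).
  rewrite (scalar_brC _ e x1) (scalar_brC _ e y1) (scalar_brC _ e x2) (scalar_brC _ e y2).
  by rewrite /b1 /b2 /b3 /b4 /om; ring.
have om0E u v : xi (c u v) = f1 u * f2 v - f2 u * f1 v + f3 u * f4 v - f4 u * f3 v.
  rewrite {1}(dec u) {1}(dec v) !brE !scE !calt linear0 xy1 xx xy yy xy2.
  rewrite (scalar_brC _ x1 y1) (scalar_brC _ x1 x2) (scalar_brC _ x1 y2).
  rewrite (scalar_brC _ y1 x2) (scalar_brC _ y1 y2) (scalar_brC _ x2 y2).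
  rewrite xy1 xx xy yx yy xy2.
  rewrite (scalar_brC xi e y1) (scalar_brC xi e y2) (scalar_brC xi x1 e) (scalar_brC xi x2 e).
  by rewrite [xi (c e y1)]e1 [xi (c e y2)]e3 [xi (c x1 e)]e2 [xi (c x2 e)]e4; ring.
(* The coefficients of [t1], which must not vanish: those of [b], or those of the coordinate [f1] if
   [b] is 0. *)
have [a1 [a2 [a3 [a4 [aE a_neq0]]]]] : exists a1 a2 a3 a4,
    ([/\ a1 = b1, a2 = b2, a3 = b3 & a4 = b4] \/
    [/\ b1 = 0, b2 = 0, b3 = 0 & b4 = 0])
    /\ [|| a1 != 0, a2 != 0, a3 != 0 | a4 != 0].
  have [bn|] := boolP [|| b1 != 0, b2 != 0, b3 != 0 | b4 != 0].
    by exists b1, b2, b3, b4; split; [left|].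
  rewrite !negb_or !negbK => /and4P[/eqP ? /eqP ? /eqP ? /eqP ?].
  by exists 1, 0, 0, 0; split; [right|rewrite oner_neq0].
pose m12 := om x1 y1; pose m13 := om x1 x2; pose m14 := om x1 y2.
pose m23 := om y1 x2; pose m24 := om y1 y2; pose m34 := om x2 y2.
pose t1 v := a1 * f1 v + a2 * f2 v + a3 * f3 v + a4 * f4 v.
(* [t0] is the contraction of the 3-form [om /\ t1] by the symplectic form:
   on a 4-space, multiplication by a symplectic form maps 1-forms onto 3-forms. *)
pose t0 v := - ((m13 * a4 - m14 * a3 + m34 * a1) * f1 v +
  (m23 * a4 - m24 * a3 + m34 * a2) * f2 v +
  (m12 * a3 - m13 * a2 + m23 * a1) * f3 v +
  (m12 * a4 - m14 * a2 + m24 * a1) * f4 v).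
exists (fun w v => eta w * t1 v + xi w * t0 v); last first.
  have [v tv] : exists v, t1 v != 0.
    case/or4P: a_neq0 => an; [exists x1|exists y1|exists x2|exists y2];
      apply: contraNneq an => <-; apply/eqP; rewrite /t1 /f1 /f2 /f3 /f4.
    + by rewrite xy1 calt linear0 xy (scalar_brC xi x1 x2) xx; ring.
    + by rewrite calt linear0 xy1 yy (scalar_brC xi y1 x2) yx; ring.
    + by rewrite (scalar_brC xi y1 x2) yx xx xy2 calt linear0; ring.
    + by rewrite (scalar_brC xi y1 y2) yy xy calt linear0 xy2; ring.
  by exists v; rewrite etaz xiz mul1r mul0r addr0; apply/eqP.
split.
- by move=> w a u v; rewrite /t1 /t0 !lf1 !lf2 !lf3 !lf4; ring.
- by move=> v a u w; rewrite !scE; ring.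
move=> x y u; rewrite !om0E -!/(om _ _) (omE x y) (omE y u) (omE u x) /t1 /t0.
rewrite -/m12 -/m13 -/m14 -/m23 -/m24 -/m34.
clearbody b1 b2 b3 b4 m12 m13 m14 m23 m24 m34; clear -aE.
move: (f1 x) (f1 y) (f1 u) (f2 x) (f2 y) (f2 u) (f3 x) (f3 y) (f3 u).
move: (f4 x) (f4 y) (f4 u) (h x) (h y) (h u).
case: aE => -[-> -> -> ->] *; ring.
Qed.
End Symplectic.

(** Here eta o c = f /\ X + g /\ Y + h /\ Z. Its product with f is f /\ g /\ Y + f /\ h /\ Z, which
    the other two terms cancel. *)
Lemma decomposable_jacobi (eta xi xp : {scalar L}) (f g h X Y Z : V -> F) :
  scalar f -> scalar Y -> scalar Z ->
  (forall u v, xi (c u v) = f u * g v - g u * f v) ->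
  (forall u v, xp (c u v) = f u * h v - h u * f v) ->
  (forall u v, eta (c u v) = (f u * X v - X u * f v) + (g u * Y v - Y u * g v)
     + (h u * Z v - Z u * h v)) ->
  jacobi_form (fun w v => eta w * f v - xi w * Y v - xp w * Z v).
Proof.
move=> lf lY lZ xiE xpE etaE; split.
- by move=> w a u v; rewrite lf lY lZ; ring.
- by move=> v a u w; rewrite !scE; ring.
by move=> x y u; rewrite !xiE !xpE !etaE; ring.
Qed.

(** * The form [c] modulo the line of [z] *)

Section Line.
Variable z : L.
Hypothesis z_neq0 : z != 0.

Lemma unit_scalar : exists eta : {scalar L}, eta z = 1.
Proof.
have [|eta [etaz _]] := @separating_scalar _ 0%VS z; first by rewrite memv0.
by exists eta.
Qed.

Lemma lineE (eta : {scalar L}) w : eta z = 1 -> w \in <[z]>%VS -> w = eta w *: z.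
Proof. by move=> etaz /vlineP[k ->]; rewrite scE etaz mulr1. Qed.

Lemma line_scalar w :
  (forall f : {scalar L}, f z = 0 -> f w = 0) -> w \in <[z]>%VS.
Proof.
move=> fw; apply/negPn/negP => /separating_scalar[f [fw1 fz]].
by have := fw f (fz _ (memv_line z)); rewrite fw1 => /eqP; rewrite oner_eq0.
Qed.

(** Modulo [z] the form is determined by the map [c e] on the kernel of [f], and [psi] inverts this
    map up to the radical. The term [eta w * f v] makes [t z] equal to [f]; its Jacobi defect
    consists of values of [om] on the kernel of [f], which the terms in [psi] cancel. *)
Lemma isotropic_hyperplane_jacobi (f : {scalar V}) e :
  2%:R != 0 :> F -> f e = 1 ->
  (forall u v, f u = 0 -> f v = 0 -> c u v \in <[z]>%VS) ->
  (forall u v, (forall w, c u w \in <[z]>%VS) -> (forall w, c v w \in <[z]>%VS) ->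
     c u v = 0) ->
  exists2 t, jacobi_form t & exists v, t z v <> 0.
Proof.
move=> two_neq0 fe Kz Riso; have [eta etaz] := unit_scalar.
pose k v := v - f v *: e.
have kl : linear k.
  by move=> a u v; rewrite /k !scE scalerDl scalerBr opprD addrACA -scalerA.
have fk v : f (k v) = 0 by rewrite /k !scE fe mulr1 subrr.
have cek v : c e (k v) = c e v.
  by rewrite /k brD2 -scaleNr brZ2 calt scaler0 addr0.
pose q w := w - eta w *: z.
have ql : linear q.
  by move=> a u v; rewrite /q !scE scalerDl scalerBr opprD addrACA -scalerA.
have qz : q z = 0 by rewrite /q etaz scale1r subrr.
have phil : linear (fun v => q (c e v)) by move=> a u v; rewrite !brE ql.
(* A generalised inverse of [c e] modulo [z]; projecting by [k] puts the values of [psi] into the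
   kernel of [f]. *)
have [Psi PsiE] := linear_partial_inverse phil.
pose psi w := k (Psi (q w)).
have psil : linear psi by move=> a u v; rewrite /psi ql linearP kl.
have psiD u v : psi (u + v) = psi u + psi v.
  by have := psil 1 u v; rewrite !scale1r.
have psi0 : psi 0 = 0 by have := psil (-1) 0 0; rewrite scaleN1r addNr scaleN1r addNr.
have psiZ a u : psi (a *: u) = a *: psi u by have := psil a u 0; rewrite psi0 !addr0.
have psiz : psi z = 0 by rewrite /psi qz linear0 /k linear0 scale0r subr0.
pose P v := psi (c e v).
have qP v : q (c e (P v)) = q (c e v) by rewrite /P /psi cek; exact: PsiE.
have fP v : f (P v) = 0 by rewrite /P /psi fk.
(* [k v - P v] lies in the radical modulo [z], so [om] vanishes on pairs of such vectors; expanding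
   this gives [omkP]. *)
have kPR v w : c (k v - P v) w \in <[z]>%VS.
  have -> : w = f w *: e + k w by rewrite /k addrC subrK.
  rewrite brD2 brZ2 rpredD//; last by apply: Kz => //; rewrite scalar_add scalar_opp fk fP subr0.
  rewrite rpredZ// brC rpredN brD2 -scaleN1r brZ2 scaleN1r cek.
  have := qP v; rewrite /q => /(canRL (subrK _)) ->.
  by rewrite opprD addrA opprB addrCA subrr addr0 -scalerBl rpredZ// memv_line.
pose om u v := eta (c u v).
have omkP u v : om (k u) (k v) = om (k u) (P v) - om (k v) (P u) - om (P u) (P v).
  have sub4 a a' b b' : om (a - a') (b - b') = om a b - om a b' + om b a' + om a' b'.
    by rewrite /om (scalar_brC eta a' b) -!scaleN1r !brE !scE; ring.
  have : om (k u - P u) (k v - P v) = 0 by rewrite /om Riso// linear0.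
  rewrite sub4 => h; apply/eqP; rewrite -subr_eq0 -h; apply/eqP; ring.
have cE u v : c u v = f u *: c e v - f v *: c e u + om (k u) (k v) *: z.
  have expand a b r t : c (r *: e + a) (t *: e + b) = r *: c e b - t *: c e a + c a b.
    rewrite !brD1 !brD2 !brZ1 !brZ2 calt !scaler0 add0r (brC e a) scalerN.
    by rewrite addrA.
  rewrite -(lineE etaz (Kz _ _ (fk u) (fk v))) -{1}(cek v) -{1}(cek u) -expand.
  by rewrite /k ![_ *: e + _]addrC !subrK.
have psic u v : psi (c u v) = f u *: P v - f v *: P u.
  by rewrite cE !psiD -!scaleNr !psiZ psiz scaler0 addr0.
have PD u v : P (u + v) = P u + P v by rewrite /P brD2 psiD.
have PZ a v : P (a *: v) = a *: P v by rewrite /P brZ2 psiZ.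
have kD u v : k (u + v) = k u + k v by have := kl 1 u v; rewrite !scale1r.
have kZ a v : k (a *: v) = a *: k v.
  by rewrite /k scE scalerBr scalerA.
(* In the cyclic sum each product of a value of [f] with [om (P _) (P _)] arises twice from the last
   term, hence the factor 1/2. *)
exists (fun w v => eta w * f v - om (psi w) (k v) + om (psi w) (P v) / 2%:R); last first.
  by exists e; rewrite /om psiz !br01 linear0 etaz fe mulr1 subr0 mul0r addr0; apply/eqP/oner_neq0.
have omDl a a' b : om (a + a') b = om a b + om a' b by rewrite /om brD1 scE.
have omDr a b b' : om a (b + b') = om a b + om a b' by rewrite /om brD2 scE.
have omZl r a b : om (r *: a) b = r * om a b by rewrite /om brZ1 scE.
have omZr r a b : om a (r *: b) = r * om a b by rewrite /om brZ2 scE.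
have omC a b : om b a = - om a b by rewrite /om scalar_brC.
have etac u v : eta (c u v) = f u * om e v - f v * om e u + om (k u) (k v).
  by rewrite cE -scaleNr !scalar_add !scalar_scale etaz /om; ring.
clearbody om psi P k.
split.
- by move=> w a u v; rewrite kD kZ PD PZ !omDr !omZr scalar_add scalar_scale; ring.
- by move=> v a u w; rewrite psiD psiZ !omDl !omZl scalar_add scalar_scale; ring.
move=> x y u; rewrite !psic !etac !omkP -!scaleNr !omDl !omZl.
rewrite (omC (k x) (P u)) (omC (k x) (P y)) (omC (k y) (P u)) (omC (k y) (P x)).
rewrite (omC (k u) (P x)) (omC (k u) (P y)).
rewrite (omC (P x) (P y)) (omC (P x) (P u)) (omC (P y) (P u)).
by field.
Qed.

(** * Consequences when every Jacobi form vanishes at [z] *)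

Hypothesis two_neq0 : 2%:R != 0 :> F.
Hypothesis dimV : (\dim {:V} <= 5)%N.
Hypothesis nocap : forall t, jacobi_form t -> forall v, t z v = 0.

(** Otherwise a multiple of [v] completes [x], [y], [u] to a symplectic quadruple, and
    [symplectic_jacobi] contradicts [nocap]. Thus [xi] o [c] has rank at most 2. *)
Lemma no_symplectic (xi : {scalar L}) x y u v : xi z = 0 -> xi (c x y) = 1 ->
  xi (c u x) = 0 -> xi (c u y) = 0 -> xi (c v x) = 0 -> xi (c v y) = 0 ->
  xi (c u v) = 0.
Proof.
move=> xiz xy1 ux uy vx vy; apply/eqP/negPn/negP => uv.
have xC a b : xi (c b a) = 0 -> xi (c a b) = 0 by rewrite scalar_brC => /eqP; rewrite oppr_eq0 => /eqP.
have [|||||t tj [w]] := @symplectic_jacobi z xi x y u ((xi (c u v))^-1 *: v) z_neq0 xiz xy1 _ _ _ _ _ dimV.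
- by rewrite brZ2 scE mulVf.
- exact: xC.
- by rewrite brZ2 scE (xC x v) ?mulr0.
- exact: xC.
- by rewrite brZ2 scE (xC y v) ?mulr0.
- by rewrite nocap.
Qed.

Lemma rank2_form (xi : {scalar L}) x y u v : xi z = 0 -> xi (c x y) = 1 ->
  xi (c u v) = xi (c u y) * xi (c x v) - xi (c x u) * xi (c v y).
Proof.
move=> xiz xy1.
(* Both [u] and [v] are projected onto the orthogonal complement of [x] and [y]. *)
have := @no_symplectic xi x y (u + (- xi (c u y)) *: x + (- xi (c x u)) *: y)
  (v + (- xi (c v y)) *: x + (- xi (c x v)) *: y) xiz xy1.
rewrite !brE !scE !calt linear0 (scalar_brC xi x y) xy1 (scalar_brC xi x u) (scalar_brC xi x v).
rewrite (scalar_brC xi v y) => H.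
have /eqP := H ltac:(ring) ltac:(ring) ltac:(ring) ltac:(ring).
by rewrite -subr_eq0 => h; apply/eqP; rewrite -subr_eq0 -(eqP h); apply/eqP; ring.
Qed.

(** Rank at most 2, stated without normalising [xi], so that the identity can be polarised. A
    nonzero entry in the row of [a] is brought to the front by permuting [b], [u], [v]; without one
    all terms vanish. *)
Lemma pfaffian_eq0 (xi : {scalar L}) a b u v : xi z = 0 ->
  xi (c a b) * xi (c u v) - xi (c a u) * xi (c b v) + xi (c a v) * xi (c b u) = 0.
Proof.
move=> xiz.
have main a' b' u' v' : xi (c a' b') != 0 ->
    xi (c a' b') * xi (c u' v') - xi (c a' u') * xi (c b' v') + xi (c a' v') * xi (c b' u') = 0.
  move=> ab.
  rewrite (@rank2_form xi a' ((xi (c a' b'))^-1 *: b') u' v')//; last by rewrite brZ2 scE mulVf.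
  by rewrite !brZ2 !scE (scalar_brC xi b' u') (scalar_brC xi b' v'); field.
have [ab|] := eqVneq (xi (c a b)) 0; last exact: main.
have [au|au] := eqVneq (xi (c a u)) 0; last first.
  by rewrite -[RHS](oppr0) -(main a u b v au) (scalar_brC xi b u); ring.
have [av|av] := eqVneq (xi (c a v)) 0; first by rewrite ab au av !mul0r subr0 addr0.
by rewrite -(main a v b u av) (scalar_brC xi u v) (scalar_brC xi b v); ring.
Qed.

(** Polarisation: for [f] killing [z] the Pfaffians of [f] and [xi + f] vanish, and so does
    [xi (c u v)]; the difference of the two leaves only [f (c u v)]. *)
Lemma isotropic_complement (xi : {scalar L}) x y u v : xi z = 0 -> xi (c x y) = 1 ->
  xi (c u x) = 0 -> xi (c u y) = 0 -> xi (c v x) = 0 -> xi (c v y) = 0 ->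
  c u v \in <[z]>%VS.
Proof.
move=> xiz xy1 ux uy vx vy; apply: line_scalar => f fz.
have [|s sE] := @scalarP_ex L (fun w => xi w + f w).
  by move=> r w w'; rewrite !scE; ring.
have := @pfaffian_eq0 s x y u v; rewrite -!sE xiz fz addr0 => /(_ erefl).
have := @pfaffian_eq0 f x y u v fz.
have := @no_symplectic xi x y u v xiz xy1 ux uy vx vy.
rewrite xy1 (scalar_brC xi u x) (scalar_brC xi v x) (scalar_brC xi u y) (scalar_brC xi v y).
rewrite ux uy vx vy => -> h1 h2.
by rewrite -[RHS](subrr 0) -[X in _ = X - _]h2 -[X in _ = _ - X]h1; ring.
Qed.

(** * Exclusion of a [c]-isotropic radical modulo [z] *)

Section IsotropicRadical.
Hypothesis radical_isotropic :
  forall u v, (forall w, c u w \in <[z]>%VS) -> (forall w, c v w \in <[z]>%VS) ->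
  c u v = 0.

(** Otherwise the kernel of [xi] o [c x], spanned by [x] and the complement of [x] and [y], is a
    hyperplane isotropic modulo [z]. *)
Lemma no_isotropic_hyperplane (xi : {scalar L}) x y :
  xi z = 0 -> xi (c x y) = 1 ->
  ~ (forall n, xi (c n x) = 0 -> xi (c n y) = 0 -> c x n \in <[z]>%VS).
Proof.
move=> xiz xy1 xN.
have [f fE] := scalarP_ex (@scalar_brr xi x).
have fx0 n : f n = 0 -> exists r m, [/\ n = r *: x + m, xi (c m x) = 0 & xi (c m y) = 0].
  rewrite -fE => fn; exists (xi (c n y)), (n - xi (c n y) *: x); split.
  - by rewrite addrC subrK.
  - by rewrite -scaleNr !brE !scE calt linear0 (scalar_brC xi x n) fn; ring.
  - by rewrite -scaleNr !brE !scE xy1; ring.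
have fy1 : f y = 1 by rewrite -fE.
have fK u v : f u = 0 -> f v = 0 -> c u v \in <[z]>%VS.
  move=> /fx0[r [m [-> mx my]]] /fx0[s [n [-> nx ny]]].
  rewrite !brE calt scaler0 add0r (brC x m) !rpredD ?rpredZ ?rpredN ?xN//.
  exact: (isotropic_complement xiz xy1).
have [t tj [v]] := isotropic_hyperplane_jacobi two_neq0 fy1 fK radical_isotropic.
by rewrite nocap.
Qed.

Lemma scalar_sum (U : vectType F) (f g : {scalar U}) r :
  exists h : {scalar U}, forall u, h u = f u + r * g u.
Proof.
have [|h hE] := @scalarP_ex U (fun u => f u + r * g u).
  by move=> a u v; rewrite !scE; ring.
by exists h.
Qed.

(** The Pfaffian on [x], [y], [n], [m] reduces to this minor, since [c n m] lies on the line of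
    [z]. *)
Lemma proportional_columns (xi : {scalar L}) x y n m (f : {scalar L}) :
  xi z = 0 -> xi (c x y) = 1 -> xi (c n x) = 0 -> xi (c n y) = 0 ->
  xi (c m x) = 0 -> xi (c m y) = 0 -> f z = 0 ->
  f (c x n) * f (c y m) = f (c x m) * f (c y n).
Proof.
move=> xiz xy1 nx ny mx my fz.
have := @pfaffian_eq0 f x y n m fz.
have /lineE nm := isotropic_complement xiz xy1 nx ny mx my.
have [eta etaz] := unit_scalar.
rewrite (nm _ etaz) scE fz !mulr0 sub0r => h.
by apply/eqP; rewrite eq_sym -subr_eq0 -h; apply/eqP; ring.
Qed.

(** Modulo [z] and the radical, [c] turns out to be the exterior square of a space with basis [x],
    [y], [n1]. Functionals dual to [z], [c x y], [p], [q] then supply the data of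
    [decomposable_jacobi]. *)
Lemma no_isotropic_radical : (0 < \dim {:V})%N -> False.
Proof.
move=> dV0; have [eta0 etaz0] := unit_scalar.
have [[x [y cxy]]|cz] := EM (exists x y, c x y \notin <[z]>%VS); last first.
  (* If all values of [c] lie on the line of [z], all of [V] is radical, so [c] is 0 and [eta0]
     tensor any functional is a Jacobi form. *)
  have {cz}cz x y : c x y \in <[z]>%VS.
    by apply/negPn/negP => xy; apply: cz; exists x, y.
  have [v0 v0n] : exists v0 : V, v0 != 0.
    by exists (vpick {:V}); rewrite vpick0 -dimv_eq0 -lt0n.
  have [|f [f1 _]] := @separating_scalar _ 0%VS v0; first by rewrite memv0.
  have /nocap/(_ v0) : jacobi_form (fun w v => eta0 w * f v).
    split=> [w a u v|v a u w|u v w]; rewrite ?scE; try ring.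
    by rewrite !(radical_isotropic (cz _) (cz _)) linear0 !mul0r !addr0.
  by rewrite f1 etaz0 mulr1 => /eqP; rewrite oner_eq0.
have [xi [xixy xiz']] := separating_scalar cxy.
have xiz : xi z = 0 by rewrite xiz' ?memv_line.
pose N n := xi (c n x) = 0 /\ xi (c n y) = 0.
have Nz n m : N n -> N m -> c n m \in <[z]>%VS.
  by move=> [nx ny] [mx my]; exact: (isotropic_complement xiz xixy).
have prop (f : {scalar L}) n m : N n -> N m -> f z = 0 ->
    f (c x n) * f (c y m) = f (c x m) * f (c y n).
  by move=> [nx ny] [mx my]; exact: (proportional_columns xiz xixy).
have [n1 [Nn1 pz]] : exists n1, N n1 /\ c x n1 \notin <[z]>%VS.
  apply: contrapT => h; apply: (no_isotropic_hyperplane xiz xixy) => n nx ny.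
  by apply/negPn/negP => nz; apply: h; exists n.
pose p := c x n1; pose q := c y n1.
have xip : xi p = 0 by rewrite /p scalar_brC Nn1.1 oppr0.
have xiq : xi q = 0 by rewrite /q scalar_brC Nn1.2 oppr0.
have [xp [xpp xpz']] := separating_scalar pz.
have xpz : xp z = 0 by rewrite xpz' ?memv_line.
(* If [q] were [t *: p] modulo [z], then [y - t *: x] would pair into the line of [z] with [n1] and,
   by proportionality, with all of [N], which [no_isotropic_hyperplane] forbids. *)
have qpz : q \notin (<[p]> + <[z]>)%VS.
  apply/negP => /memv_addP[_ /vlineP[t ->] [w wz qE]].
  have y'n1 : c (y - t *: x) n1 = w.
    by rewrite -scaleNr !brE scaleNr -/q -/p qE addrAC subrr add0r.
  apply: (@no_isotropic_hyperplane xi (y - t *: x) (- x) xiz).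
    by rewrite -scaleNr -scaleN1r !brE !scE calt linear0 (scalar_brC xi x y) xixy; ring.
  move=> n ny' nx.
  have Nn : N n.
    have nx0 : xi (c n x) = 0.
      by apply/eqP; rewrite -oppr_eq0 -nx -scaleN1r brZ2 scE mulN1r.
    split=> //; move: ny'; rewrite -scaleNr !brE !scE nx0 mulr0 addr0 //.
  apply: line_scalar => f fz.
  have key (g : {scalar L}) : g z = 0 -> g p * g (c (y - t *: x) n) = 0.
    move=> gz; have gw : g w = 0 by rewrite (lineE etaz0 wz) scE gz mulr0.
    have := prop g n1 n Nn1 Nn gz; rewrite -/p -/q qE !scE gw addr0 => h.
    by rewrite -scaleNr !brE !scE mulrDr h; ring.
  (* As [f p] may be 0, [key] is applied to [f + xp] too; the products left over vanish by [key] for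
     [f] and for [xp]. *)
  have h1 := key _ xpz; rewrite xpp mul1r in h1.
  have [g gE] := scalar_sum f xp 1.
  have := key g; rewrite !gE fz xpz xpp h1 mulr0 !addr0 => /(_ erefl).
  by rewrite mulrDl (key f fz) add0r !mul1r.
have [xq0 [xq0q xq0']] := separating_scalar qpz.
have xq0p : xq0 p = 0 by rewrite xq0' // memvE addvSl.
have xq0z : xq0 z = 0 by rewrite xq0' // memvE addvSr.
(* Elimination makes [xi], [xr], [xq], [eta] dual to [c x y], [p], [q], [z]. *)
have [xq xqE] := scalar_sum xq0 xi (- xq0 (c x y)).
have [xp1 xp1E] := scalar_sum xp xq0 (- xp q).
have [xr xrE] := scalar_sum xp1 xi (- xp1 (c x y)).
have [xqz xqp xqq xqxy] : [/\ xq z = 0, xq p = 0, xq q = 1 & xq (c x y) = 0].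
  by rewrite !xqE xq0z xq0p xq0q xiz xip xiq xixy; split; ring.
have [xrz xrp xrq xrxy] : [/\ xr z = 0, xr p = 1, xr q = 0 & xr (c x y) = 0].
  by rewrite !xrE !xp1E xq0z xq0p xq0q xpp xpz xiz xip xiq xixy; split; ring.
have [eta1 eta1E] := scalar_sum eta0 xi (- eta0 (c x y)).
have [eta2 eta2E] := scalar_sum eta1 xr (- eta0 p).
have [eta etaE] := scalar_sum eta2 xq (- eta0 q).
have [etaz etap etaq etaxy] : [/\ eta z = 1, eta p = 0, eta q = 0 & eta (c x y) = 0].
  rewrite !etaE !eta2E !eta1E etaz0 xiz xip xiq xixy xqz xqp xqq xqxy xrz xrp xrq xrxy.
  by split; ring.
have [f fE] := scalarP_ex (@scalar_brl xi y).
have [g gE] := scalarP_ex (@scalar_brr xi x).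
have [a aE] := scalarP_ex (@scalar_brr xr x).
(* On [N], modulo [z], [c y] is [a] times [q] and [c x] is [a] times [p]; both follow by polarising
   [prop]. *)
have coly (h : {scalar L}) n : N n -> h z = 0 -> h (c y n) = a n * h q.
  move=> Nn hz; have xrn : xr (c y n) = 0.
    by have := prop xr n1 n Nn1 Nn xrz; rewrite -/p -/q xrp xrq mul1r mulr0.
  have [s sE] := scalar_sum h xr 1.
  have := prop s n1 n Nn1 Nn; rewrite -/p -/q !sE hz xrz xrp xrq xrn -aE => /(_ _).
  have := prop h n1 n Nn1 Nn hz; rewrite -/p -/q => h1 h2.
  by apply: (eq_sub2 (h2 ltac:(ring)) h1); ring.
have colx (h : {scalar L}) n : N n -> h z = 0 -> h (c x n) = a n * h p.
  move=> Nn hz; have xqn : xq (c x n) = 0.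
    by have := prop xq n1 n Nn1 Nn xqz; rewrite -/p -/q xqp xqq mul0r mulr1.
  have [s sE] := scalar_sum h xq 1.
  have := prop s n1 n Nn1 Nn; rewrite -/p -/q !sE hz xqz xqp xqq xqn => /(_ _).
  have := prop h n1 n Nn1 Nn hz; rewrite -/p -/q (coly xq n Nn xqz) xqq => h1 h2.
  by apply/esym/(eq_sub2 (h2 ltac:(ring)) h1); ring.
have Nlin n m k : N n -> N m -> N (n + k *: m).
  by case=> nx ny [mx my]; split; rewrite !brE !scE ?nx ?ny ?mx ?my; ring.
pose nn v := v - f v *: x - g v *: y.
have Nnn v : N (nn v).
  split; rewrite /nn -!scaleNr !brE !scE calt linear0 ?(scalar_brC xi x y) ?xixy.
    by rewrite (scalar_brC xi x v) -gE; ring.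
  by rewrite -fE; ring.
have ann v : a (nn v) = a v.
  by rewrite /nn -!scaleNr !scE -!aE calt linear0 xrxy; ring.
(* [r v] is the radical component of [v]; the rest is a combination of [x], [y], [n1]. *)
pose r v := nn v - a v *: n1.
have ar v : a (r v) = 0.
  by rewrite /r -scaleNr scalar_add scalar_scale ann -(aE n1) -/p xrp; ring.
have rR v w : c (r v) w \in <[z]>%VS.
  have Nr : N (r v) by rewrite /r -scaleNr; exact: Nlin.
  have -> : w = f w *: x + g w *: y + nn w by rewrite /nn -[X in _ + X]addrA -opprD addrCA subrr addr0.
  rewrite brD2; apply: rpredD; last exact: Nz.
  rewrite brD2 !brZ2 rpredD ?rpredZ// brC rpredN; apply: line_scalar => h hz.
    by rewrite colx// ar mul0r.
  by rewrite coly// ar mul0r.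
(* Obtained by expanding [c (r u) (r v) = 0]; the normalisation of [eta] removes the terms in
   [c x y], [p], [q]. *)
have etaE' u v : eta (c u v) = (f u * eta (c x v) - eta (c x u) * f v)
   + (g u * eta (c y v) - eta (c y u) * g v) + (a u * eta (c n1 v) - eta (c n1 u) * a v).
  have := radical_isotropic (rR u) (rR v); rewrite /r /nn -!scaleNr => /(congr1 eta).
  rewrite linear0 !brE !scE !calt linear0 (scalar_brC eta x y) (scalar_brC eta y n1).
  rewrite (scalar_brC eta x n1) -/p -/q etaxy etap etaq.
  rewrite (scalar_brC eta x u) (scalar_brC eta y u) (scalar_brC eta n1 u) => h.
  by apply/eqP; rewrite -subr_eq0 -h; apply/eqP; ring.
have xiE u v : xi (c u v) = f u * g v - g u * f v.
  by rewrite (rank2_form _ _ xiz xixy) -!fE -!gE.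
have xrE' u v : xr (c u v) = f u * a v - a u * f v.
  have := lineE etaz (Nz _ _ (Nnn u) (Nnn v)) => /(congr1 xr).
  rewrite scE xrz mulr0 => h.
  have xry w : xr (c y w) = 0.
    have := coly xr _ (Nnn w) xrz; rewrite xrq mulr0 /nn -!scaleNr !brE !scE calt linear0.
    by rewrite (scalar_brC xr x y) xrxy => <-; ring.
  move: h; rewrite /nn -!scaleNr !brE !scE !calt linear0 (scalar_brC xr x u) (scalar_brC xr y u).
  rewrite (scalar_brC xr x y) xrxy !xry !aE => h.
  by apply/eqP; rewrite -subr_eq0 -h; apply/eqP; ring.
have /nocap/(_ x)/eqP := decomposable_jacobi (linearP f) (@scalar_brr eta y) (@scalar_brr eta n1) xiE xrE' etaE'.
by rewrite etaz xiz xrz !mul0r !subr0 mul1r -fE xixy oner_eq0.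
Qed.
End IsotropicRadical.

(** Since the radical modulo [z] is not isotropic, it contains [a] and [b] with [c a b = z] after
    scaling. The clause on [U] puts [z] in the span of the values of [c] on the common centraliser
    of [a] and [b]; it will place [z] in the derived subgroup of the second factor. *)
Lemma hyperbolic_pair : (0 < \dim {:V})%N -> exists a b,
  [/\ c a b = z, forall v, c a v \in <[z]>%VS, forall v, c b v \in <[z]>%VS
    & forall U : {vspace L},
        (forall u v, c a u = 0 -> c b u = 0 -> c a v = 0 -> c b v = 0 -> c u v \in U) ->
        z \in U].
Proof.
move=> dV0; have [eta0 etaz0] := unit_scalar.
have [[a [b' [aR bR abn]]]|noab] := EM (exists a b,
    [/\ forall w, c a w \in <[z]>%VS, forall w, c b w \in <[z]>%VS & c a b <> 0]); last first.
  case: no_isotropic_radical => // u v uR vR; apply: contrapT => uv.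
  by apply: noab; exists u, v.
have abE := lineE etaz0 (aR b').
have k_neq0 : eta0 (c a b') != 0 by apply/eqP => k0; apply: abn; rewrite abE k0 scale0r.
pose b := (eta0 (c a b'))^-1 *: b'.
have ab : c a b = z by rewrite /b brZ2 {2}abE scalerA mulVf// scale1r.
have {}bR w : c b w \in <[z]>%VS by rewrite /b brZ1 rpredZ.
exists a, b; split=> // U CU; apply/negPn/negP => /separating_scalar[eta [etaz etaU]].
have [f fE] := scalarP_ex (@scalar_brr eta a).
have [g gE] := scalarP_ex (@scalar_brr eta b).
clearbody b.
have Ca u : c a (u - f u *: b + g u *: a) = 0.
  by rewrite -scaleNr !brE ab calt scaler0 addr0 (lineE etaz (aR u)) -fE scaleNr subrr.
have Cb u : c b (u - f u *: b + g u *: a) = 0.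
  rewrite -scaleNr !brE (brC a b) ab calt scaler0 addr0 (lineE etaz (bR u)) -gE.
  by rewrite scalerN subrr.
(* Every vector is a centralising one plus a combination of [a] and [b], so eta o c = f /\ g. Its
   product with f is 0, which makes [eta] tensor [f] a Jacobi form that is nonzero at [z]. *)
have etaE u v : eta (c u v) = f u * g v - g u * f v.
  have := etaU _ (CU _ _ (Ca u) (Cb u) (Ca v) (Cb v)).
  rewrite -!scaleNr !brE !scE !calt linear0 (scalar_brC eta a b) ab etaz.
  rewrite (scalar_brC eta a u) (scalar_brC eta b u) !fE !gE => h.
  by apply/eqP; rewrite -subr_eq0 -h; apply/eqP; ring.
have /nocap/(_ b) : jacobi_form (fun w v => eta w * f v).
  split=> [w r u v|v r u w|u v w]; rewrite ?scE ?etaE; ring.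
by rewrite etaz -fE ab etaz mulr1 => /eqP; rewrite oner_eq0.
Qed.
End Line.
End JacobiForms.

(** * Capable groups and central products *)

Local Open Scope classical_set_scope.
Local Open Scope quotient_scope.
Local Open Scope group_scope.

Lemma gen_subgroup_group (G : groupType) (A : set G) : is_subgroup (gen_subgroup A).
Proof.
split=> [B [] []//|x y Ax Ay B BA|x Ax B BA].
  by have [[_ BM _] _] := BA; apply: BM; [apply: Ax|apply: Ay].
by have [[_ _ BV] _] := BA; apply: BV; apply: Ax.
Qed.

Lemma sub_gen_subgroup (G : groupType) (A : set G) : A `<=` gen_subgroup A.
Proof. by move=> x Ax B [_]; apply. Qed.

Lemma gen_subgroup_min (G : groupType) (A B : set G) :
  is_subgroup B -> A `<=` B -> gen_subgroup A `<=` B.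
Proof. by move=> sB AB x; apply. Qed.

Lemma factor_mulE (G : groupType) (N : normal_subgroup G) (x y : G) :
  (\pi_(factor_group N) x * \pi_(factor_group N) y) = \pi_(factor_group N) (x * y).
Proof. exact: quo_mulE. Qed.

Lemma factor_eq1 (G : groupType) (N : normal_subgroup G) (x : G) :
  \pi_(factor_group N) x = 1 <-> nsub_set N x.
Proof.
have [N1 _ NV] := nsub_group N; split.
  by move/esym/quo_eqP; rewrite invg1 mul1g.
by move=> Nx; apply/esym/quo_eqP; rewrite invg1 mul1g.
Qed.

Lemma morphV (G H : groupType) (f : G -> H) :
  {morph f : x y / x * y} -> f 1 = 1 /\ {morph f : x / x^-1}.
Proof.
move=> fM; have f1 : f 1 = 1 by apply: (@mulgI _ (f 1)); rewrite -fM !mulg1.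
by split=> // x; apply: (@mulgI _ (f x)); rewrite -fM !mulgV.
Qed.

Lemma multiplicative_ex (G H : groupType) (f : G -> H) :
  {morph f : x y / x * y} -> exists g : {multiplicative G -> H}, f = g.
Proof.
by move=> fM; exists (HB.pack_for {multiplicative G -> H} f (isMultiplicative.Build G H f fM)).
Qed.

Lemma first_isomorphism (K G : groupType) (N : normal_subgroup K) (f : K -> G) :
  {morph f : x y / x * y} -> (forall g, exists k, f k = g) ->
  (forall k, nsub_set N k <-> f k = 1) -> isomorphic G (factor_group N).
Proof.
move=> fM fsurj fker; have [f1 fV] := morphV fM.
have [s sK] := choice fsurj.
have eqf k l : \pi_(factor_group N) k = \pi_(factor_group N) l <-> f k = f l.
  split=> [/quo_eqP/fker|kl].
    by rewrite fM fV => /mulg1_eq; rewrite invgK.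
  by apply/quo_eqP/fker; rewrite fM fV kl mulVg.
have [g gE] : exists g : {multiplicative G -> factor_group N},
    (fun x => \pi_(factor_group N) (s x)) = g.
  by apply: multiplicative_ex => x y; rewrite factor_mulE; apply/eqf; rewrite fM !sK.
exists g; exists (fun q => f (repr q)) => [x|q]; rewrite -gE.
  rewrite -[RHS]sK; apply/eqf; exact: reprK.
by rewrite -[RHS](reprK q); apply/eqf; rewrite sK.
Qed.

Lemma isomorphic_factorE (K G : groupType) (N : normal_subgroup K) :
  isomorphic G (factor_group N) -> exists f : K -> G,
  [/\ {morph f : x y / x * y}, forall g, exists k, f k = g
    & forall k, nsub_set N k <-> f k = 1].
Proof.
move=> [f [g fK gK]]; have gM : {morph g : x y / x * y}.
  by move=> x y; rewrite -{1}(gK x) -{1}(gK y) -gmulfM fK.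
have [g1 gV] := morphV gM.
exists (fun k => g (\pi_(factor_group N) k)); split=> [x y|x|k].
- by rewrite -factor_mulE gM.
- by exists (repr (f x)); rewrite reprK fK.
split=> [/factor_eq1 -> //|h].
by apply/factor_eq1/(can_inj gK); rewrite h g1.
Qed.

Lemma conjg_commute (G : groupType) (x y : G) : commute x y -> x ^ y = x.
Proof. by rewrite /conjg => ->; rewrite mulKg. Qed.

Lemma commgMcenter (G : groupType) (x y z : G) :
  group_center G z -> [~ x, y * z] = [~ x, y].
Proof.
by move=> zZ; rewrite /commg conjgM [_ ^ z]conjg_commute//; exact/commute_sym/zZ.
Qed.

Lemma commg_center_mull (G : groupType) (x y z : G) :
  group_center G z -> [~ x * z, y] = [~ x, y].
Proof. by move=> zZ; rewrite -invgR commgMcenter// invgR. Qed.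

(* Three subgroups: if preimages of two subgroups commute modulo the centre,
   then each centralises the derived subgroup of the other. *)
Lemma derived_commute (H Q G1 G2 : groupType) (f : H -> Q) (f1 : G1 -> Q) (f2 : G2 -> Q) :
  {morph f : x y / x * y} -> (forall q, exists h, f h = q) ->
  (forall h, f h = 1 -> group_center H h) ->
  {morph f1 : x y / x * y} -> (forall x y, commute (f1 x) (f2 y)) ->
  forall g x k y, derived_subgroup G1 g -> f x = f1 g -> f y = f2 k -> commute x y.
Proof.
move=> fM fsurj fker f1M f12 g x k y g' xg yk.
have [f_1 fV] := morphV fM; have [f1_1 f1V] := morphV f1M.
have fZ a b : f a = f b -> exists2 w, group_center H w & a = b * w.
  move=> ab; exists (b^-1 * a); last by rewrite mulVKg.
  by apply: fker; rewrite fM fV ab mulVg.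
suff : derived_subgroup G1 `<=` [set g | forall x, f x = f1 g -> commute x y].
  by move=> /(_ g g' x xg).
apply: gen_subgroup_min.
  split=> [a|a b aP bP w|a aP w] /=.
  - by rewrite f1_1 => /fker.
  - rewrite f1M; have [[u ua] [v vb]] := (fsurj (f1 a), fsurj (f1 b)).
    rewrite -ua -vb -fM => /fZ[t tZ ->].
    apply/commute_sym; do 2?[apply: commuteM]; apply/commute_sym;
      [exact: aP|exact: bP|exact: tZ].
  - rewrite f1V => wa; rewrite -[w]invgK; apply/commute_sym/commuteV/commute_sym/aP.
    by rewrite fV wa invgK.
move=> _ [a _ [b _ <-]] w /=.
have [[u ua] [v vb]] := (fsurj (f1 a), fsurj (f1 b)).
have -> : f1 [~ a, b] = f [~ u, v] by rewrite /commg /conjg !(fM, fV, f1M, f1V) ua vb.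
(* Conjugation by [y] changes lifts of elements of the first factor only by central elements, so it
   fixes their commutators. *)
have conjy c t : f t = f1 c -> exists2 s, group_center H s & t ^ y = t * s.
  move=> tc; apply: fZ; rewrite /conjg !fM fV tc yk.
  by rewrite (f12 c k) mulKg.
move=> /fZ[t tZ ->]; apply/commute_sym; apply: commuteM; last exact/commute_sym/tZ.
have [[r rZ ur] [s sZ vs]] := (conjy a u ua, conjy b v vb).
suff h : [~ u, v] ^ y = [~ u, v] by apply: esym; rewrite conjgC h.
rewrite conjRg ur vs.
by rewrite commgMcenter// commg_center_mull.
Qed.

Lemma commute_subgroup (G : groupType) (x : G) : is_subgroup [set y | commute x y].
Proof.
split=> [|y z|y] /=; [exact: commute1|exact: commuteM|exact: commuteV].
Qed.

(** * Mutual exclusion of the three cases *)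

Lemma cyclic_abelian (G : groupType) : cyclic_subgroup [set: G] -> is_abelian G.
Proof.
move=> [x xG].
have Gx y : commute x y.
  have : [set: G] y by [].
  rewrite xG; apply: (gen_subgroup_min (commute_subgroup x)) => _ -> //=.
move=> y z; apply/commute_sym.
have : [set: G] y by [].
rewrite xG; apply: (gen_subgroup_min (commute_subgroup z)) => _ -> /=; exact/commute_sym/Gx.
Qed.

(** If G = H/Z(H), then H is generated by its centre and a lift of the generator. This lift is
    therefore central, and the generator trivial. *)
Lemma cyclic_not_capable (G : groupType) : nontrivial_cyclic G -> ~ capable G.
Proof.
move=> [[x xG] [y _ y1]] [H /isomorphic_factorE[f [fM fsurj fker]]].
have [f1 fV] := morphV fM.
have [h fh] := fsurj x.
have Z k : f k = 1 -> group_center H k by move/fker.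
have hZ : group_center H h.
  move=> k; have : [set: G] (f k) by [].
  rewrite xG => /gen_subgroup_min - /(_ [set g | forall k, f k = g -> commute h k]).
  apply=> //.
    split=> [l /Z lZ|a b aP bP l|a aP l la] /=; first exact/commute_sym.
      have [[u ua] [v vb]] := (fsurj a, fsurj b); rewrite -ua -vb => luv.
      rewrite -(mulVKg (u * v) l); apply: commuteM.
        by apply: commuteM; [apply: aP|apply: bP].
      by apply/commute_sym/Z; rewrite !(fM, fV) luv mulVg.
    by rewrite -[l]invgK; apply/commuteV/aP; rewrite fV la invgK.
  move=> _ -> l lx; rewrite -(mulVKg h l); apply: commuteM => //.
  by apply/commute_sym/Z; rewrite !(fM, fV) lx fh mulVg.
have x1 : x = 1 by rewrite -fh; apply/fker.
apply: y1; have : [set: G] y by [].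
rewrite xG; apply: (gen_subgroup_min (B := [set 1])) => [|_ -> //].
by split=> [//|a b -> ->|a ->] /=; rewrite ?mulg1 ?invg1.
Qed.

Section AmalgamExclusion.
Variables (G1 G2 : groupType) (phi : amalgamation G1 G2).

Lemma amalg_map1 : amalg_map phi 1 = 1.
Proof.
have [H1 _ _] := amalg_dom_group phi.
by apply: (@mulgI _ (amalg_map phi 1)); rewrite -amalg_mapM ?inE// !mulg1.
Qed.

Lemma amalg_kernel_left x : amalg_kernel_set phi (x, 1) -> x = 1.
Proof.
have [H1 _ _] := amalg_dom_group phi.
move=> [h hd [<- h1]]; apply: (amalg_map_inj (a := phi)); rewrite ?inE//.
by rewrite amalg_map1 -[LHS]invgK h1 invg1.
Qed.

Lemma amalgam_not_abelian (G : groupType) : ~ is_abelian G1 ->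
  isomorphic G (amalgamated_product phi) -> ~ is_abelian G.
Proof.
move=> G1n /isomorphic_factorE[q [qM _ qker]] ab; apply: G1n => x y.
have [_ qV] := morphV qM.
have : q ([~ x, y], 1) = 1.
  have -> : ([~ x, y], 1) = [~ (x, 1), (y, 1)] :> (G1 * G2)%type.
    by congr (_, _); apply/esym/commgg.
  rewrite /commg /conjg !(qM, qV); exact/eqP/commgP/ab.
by move/qker/amalg_kernel_left/eqP/commgP.
Qed.

Lemma amalgam_not_capable : nontrivial_subgroup (amalg_dom phi) ->
  amalg_dom phi `<=` derived_subgroup G1 ->
  amalg_map phi @` amalg_dom phi `<=` derived_subgroup G2 ->
  forall G, isomorphic G (amalgamated_product phi) -> ~ capable G.
Proof.
move=> [h hd h1] d1 d2 G /isomorphic_factorE[q [qM qsurj qker]].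
move=> [H /isomorphic_factorE[f [fM fsurj fker]]].
have [f1 fV] := morphV fM; have [q1 qV] := morphV qM.
pose i1 x := q (x, 1); pose i2 y := q (1, y).
have i1M : {morph i1 : x y / x * y}.
  by move=> x y; rewrite /i1 -qM; congr (q (_, _)); rewrite /= mulg1.
have i2M : {morph i2 : x y / x * y}.
  by move=> x y; rewrite /i2 -qM; congr (q (_, _)); rewrite /= mulg1.
have i12 x y : commute (i1 x) (i2 y).
  by rewrite /commute /i1 /i2 -!qM; congr (q (_, _)); rewrite /= mulg1 mul1g.
have Z k : f k = 1 -> group_center H k by move/fker.
have hi : i1 h = i2 (amalg_map phi h).
  have : q (h, (amalg_map phi h)^-1) = 1 by apply/qker; exists h.
  have -> : (h, (amalg_map phi h)^-1) = (h, 1) * (1, amalg_map phi h)^-1.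
    by congr (_, _); rewrite /= ?invg1 ?mulg1 ?mul1g.
  by rewrite qM qV => /divg1_eq.
have [x xh] := fsurj (i1 h).
have xZ : group_center H x.
  (* [y] is a lift of an element of the first factor times a lift of one of the second. As [i1 h] is
     also the image of [amalg_map phi h], [derived_commute] handles the first through G2' and the
     second through G1'. *)
  move=> y; have [[u v] uv] := qsurj (f y); have [a au] := fsurj (i1 u).
  rewrite -(mulVKg a y); apply: commuteM.
    apply: (derived_commute fM fsurj Z i2M (f1 := i2) (f2 := i1)) au.
    - by move=> *; apply/commute_sym.
    - by apply: d2; exists h.
    - by rewrite xh.
  apply: (derived_commute fM fsurj Z i1M (f1 := i1) (f2 := i2) _ _ xh (k := v)) => //.
    exact: d1.
  rewrite fM fV -uv au /i1 /i2 -qV -qM; congr (q (_, _)) => /=.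
    by rewrite mulVg.
  by rewrite invg1 mul1g.
apply/h1/amalg_kernel_left/qker; rewrite -/(i1 h) -xh; exact/fker.
Qed.
End AmalgamExclusion.

(** * Central extensions and a cocycle criterion for capability *)

Definition cocycle (G : groupType) (A : zmodType) (f : G -> G -> A) : Prop :=
  [/\ forall g, f 1 g = 0%R, forall g, f g 1 = 0%R
    & forall g h k, (f g h + f (g * h)%g k = f h k + f g (h * k)%g)%R].

Section CentralExtension.
Variables (G : groupType) (A : zmodType) (f : G -> G -> A) (cf : cocycle f).

(** The type depends on the cocycle proof, so that it carries the twisted multiplication and not
    that of the direct product. *)
Definition extension (_ : cocycle f) : Type := (G * A)%type.
Local Notation E := (extension cf).
HB.instance Definition _ := Choice.on E.

Definition ext_one : E := (1, 0%R).
Definition ext_mul (x y : E) : E := ((x.1 * y.1)%g, (x.2 + y.2 + f x.1 y.1)%R).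
Definition ext_inv (x : E) : E := (x.1^-1, (- x.2 - f x.1 (x.1^-1)%g)%R).

Lemma cocycle_inv g : f g^-1 g = f g g^-1.
Proof.
have [f1 f2 f3] := cf; have := f3 g g^-1 g.
by rewrite mulgV mulVg f1 f2 !addr0.
Qed.

Lemma ext_mulA : associative ext_mul.
Proof.
have [_ _ f3] := cf; move=> [x a] [y b] [z d]; rewrite /ext_mul /= mulgA; congr (_, _).
by rewrite -!addrA; do 2 congr (_ + _)%R; rewrite [RHS]addrCA f3.
Qed.
Lemma ext_mul1g : left_id ext_one ext_mul.
Proof. by have [f1 _ _] := cf; move=> [x a]; rewrite /ext_mul/= f1 mul1g add0r addr0. Qed.
Lemma ext_mulg1 : right_id ext_one ext_mul.
Proof. by have [_ f1 _] := cf; move=> [x a]; rewrite /ext_mul/= f1 mulg1 !addr0. Qed.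
Lemma ext_mulVg : left_inverse ext_one ext_inv ext_mul.
Proof.
move=> [x a]; rewrite /ext_mul/= mulVg cocycle_inv; congr (_, _).
by rewrite addrAC addrNK addNr.
Qed.
Lemma ext_mulgV : right_inverse ext_one ext_inv ext_mul.
Proof.
move=> [x a]; rewrite /ext_mul/= mulgV; congr (_, _).
by rewrite addrA addrNK addrN.
Qed.
HB.instance Definition _ :=
  isGroup.Build E ext_mulA ext_mul1g ext_mulg1 ext_mulVg ext_mulgV.

(** A pair is central in the extension only if its first component [z] is central in [G] and f z g =
    f g z for all g; by hypothesis the centre is then the kernel of [fst]. *)
Lemma capable_of_cocycle :
  (forall z : G, z <> 1 -> group_center G z -> exists g, f z g <> f g z) -> capable G.
Proof.
move=> sep; exists E.
apply: (@first_isomorphism E G _ fst) => [//|g|[x a]]; first by exists (g, 0%R).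
split=> [xaZ|/= ->]; last first.
  have [f1 f2 _] := cf; move=> [y b]; congr (_, _); rewrite /= ?mul1g ?mulg1//.
  by rewrite f1 f2 !addr0 addrC.
have comm y : x * y = y * x /\ f x y = f y x.
  have := xaZ (y, 0%R) => -[xy]; by rewrite /= addr0 add0r => /addrI.
apply: contrapT => x1; have [|g] := sep x x1; first by move=> y; exact: (comm y).1.
by apply; exact: (comm g).2.
Qed.
End CentralExtension.

Lemma capable_of_cocycles (G : groupType) (A : zmodType) :
  (forall z : G, z <> 1 -> group_center G z ->
     exists2 f : G -> G -> A, cocycle f & exists g, f z g <> f g z) -> capable G.
Proof.
move=> sep.
have /choice[F FP] : forall z : G, exists f : G -> G -> A, cocycle f /\
    (z <> 1 -> group_center G z -> exists g, f z g <> f g z).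
  move=> z; have [[z1 zZ]|h] := EM (z <> 1 /\ group_center G z).
    by have [f cf gf] := sep z z1 zZ; exists f.
  exists (fun _ _ => 0%R); split; first by split=> *; rewrite ?addr0.
  by move=> z1 zZ; case: h.
(* All the cocycles are bundled into one with values in [G -> A], whose coordinate at [z] detects
   [z]. *)
have cF : @cocycle G (G -> A) (fun g h z => F z g h).
  by split=> [g|g|g h k]; apply/funext => z; have [[f1 f2 f3] _] := FP z;
    [exact: f1|exact: f2|exact: f3].
apply: (capable_of_cocycle cF) => z z1 zZ.
have [_ /(_ z1 zZ)[g gz]] := FP z; exists g => /(congr1 (@^~ z)); exact: gz.
Qed.

(** * Subgroups as groups, and internal central products *)

Section SubgroupType.
Variables (G : groupType) (A : set G) (sA : is_subgroup A).

Definition subgroup_pred (_ : is_subgroup A) : pred G := fun x => `[< A x >].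
Record subgroup_type := SubgroupElt {
  subgroup_val :> G; _ : subgroup_pred sA subgroup_val }.
HB.instance Definition _ := [isSub for subgroup_val].
HB.instance Definition _ := [Choice of subgroup_type by <:].

Lemma subgroup_valP (x : subgroup_type) : A (val x).
Proof. by apply/asboolP; exact: (valP x). Qed.
Definition subgroup_elt (x : G) (Ax : A x) : subgroup_type :=
  SubgroupElt (introT (asboolP _) Ax : subgroup_pred sA x).

Lemma subgroup1 : A 1. Proof. by case: sA. Qed.
Lemma subgroupM x y : A x -> A y -> A (x * y). Proof. by case: sA => _ + _; apply. Qed.
Lemma subgroupV x : A x -> A x^-1. Proof. by case: sA => _ _; apply. Qed.
Lemma subgroupX x n : A x -> A (x ^+ n).
Proof. by move=> Ax; elim: n => [|n IH]; [exact: subgroup1|rewrite expgS; exact: subgroupM]. Qed.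

Definition subgroup_one := subgroup_elt subgroup1.
Definition subgroup_mul x y :=
  subgroup_elt (subgroupM (subgroup_valP x) (subgroup_valP y)).
Definition subgroup_inv x := subgroup_elt (subgroupV (subgroup_valP x)).

Lemma subgroup_mulA : associative subgroup_mul.
Proof. by move=> x y z; apply: val_inj; exact: mulgA. Qed.
Lemma subgroup_mul1g : left_id subgroup_one subgroup_mul.
Proof. by move=> x; apply: val_inj; exact: mul1g. Qed.
Lemma subgroup_mulg1 : right_id subgroup_one subgroup_mul.
Proof. by move=> x; apply: val_inj; exact: mulg1. Qed.
Lemma subgroup_mulVg : left_inverse subgroup_one subgroup_inv subgroup_mul.
Proof. by move=> x; apply: val_inj; exact: mulVg. Qed.
Lemma subgroup_mulgV : right_inverse subgroup_one subgroup_inv subgroup_mul.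
Proof. by move=> x; apply: val_inj; exact: mulgV. Qed.
HB.instance Definition _ :=
  isGroup.Build subgroup_type subgroup_mulA subgroup_mul1g subgroup_mulg1
    subgroup_mulVg subgroup_mulgV.

Lemma subgroup_derived x :
  comm_subgroup A A x -> exists2 y, derived_subgroup subgroup_type y & val y = x.
Proof.
move: x; apply: gen_subgroup_min.
  split=> [|_ _ [y dy <-] [z dz <-]|_ [y dy <-]];
    have [d1 dM dV] := gen_subgroup_group [set [~ x, y] | x in [set: subgroup_type] & y in [set: subgroup_type]].
  - by exists 1.
  - by exists (y * z) => //; exact: dM.
  - by exists y^-1 => //; exact: dV.
move=> _ [x Ax [y Ay <-]]; exists [~ subgroup_elt Ax, subgroup_elt Ay] => //.
by apply: sub_gen_subgroup; exists (subgroup_elt Ax) => //; exists (subgroup_elt Ay).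
Qed.
End SubgroupType.

Section InternalProduct.
Variables (G : groupType) (A B : set G) (sA : is_subgroup A) (sB : is_subgroup B) (z : G).
Hypotheses (AB : forall a b, A a -> B b -> commute a b).
Hypotheses (GAB : forall g, exists a b, [/\ A a, B b & g = a * b]).
Hypotheses (ABz : A `&` B = gen_subgroup [set z]) (z_neq1 : z <> 1).
Hypotheses (zA : comm_subgroup A A z) (zB : comm_subgroup B B z).

Let G1 := subgroup_type sA.
Let G2 := subgroup_type sB.
Let dom : set G1 := [set x | B (val x)].
(** The identity of the intersection of [A] and [B]; the value 1 elsewhere is a default. *)
Let map (x : G1) : G2 :=
  if pselect (B (val x)) is left Bx then subgroup_elt sB Bx else 1.

Let mapE x : dom x -> val (map x) = val x.
Proof. by move=> dx; rewrite /map; case: pselect. Qed.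

Let dom_group : is_subgroup dom.
Proof.
by split=> [|x y dx dy|x dx]; [exact: (subgroup1 sB)|exact: (subgroupM sB)|exact: (subgroupV sB)].
Qed.

Let dom_center : dom `<=` group_center G1.
Proof.
by move=> x dx y; apply: val_inj; apply/commute_sym; exact: (AB (subgroup_valP y) dx).
Qed.

Let map_center : map @` dom `<=` group_center G2.
Proof.
move=> _ [x dx <-] y; apply: val_inj; rewrite /= mapE//.
exact: (AB (subgroup_valP x) (subgroup_valP y)).
Qed.

Let mapM : {in dom &, {morph map : x y / x * y}}.
Proof.
move=> x y; rewrite !inE => dx dy; apply: val_inj.
by rewrite /= !mapE//; exact: (subgroupM sB).
Qed.

Let map_inj : {in dom &, injective map}.
Proof.
move=> x y; rewrite !inE => dx dy /(congr1 val); rewrite !mapE// => xy.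
exact: val_inj.
Qed.

Let phi := Amalgamation dom_group dom_center map_center mapM map_inj.

(** Multiplication from A x B onto G is a homomorphism whose kernel consists of the pairs (h, h^-1)
    with h in both subgroups, which is the kernel of the amalgam. *)
Lemma internal_amalgam : nonabelian_amalgam G.
Proof.
have [Az Bz] : A z /\ B z.
  have : (A `&` B) z by rewrite ABz; exact: sub_gen_subgroup.
  by case.
have nonab (C : set G) (sC : is_subgroup C) : comm_subgroup C C z -> ~ is_abelian (subgroup_type sC).
  move=> Cz ab; apply: z_neq1; move: Cz; apply: (gen_subgroup_min (B := [set 1])).
    by split=> [//|a b -> ->|a ->] /=; rewrite ?mulg1 ?invg1.
  move=> _ [x Cx [y Cy <-]]; apply/eqP/commgP.
  have := ab (subgroup_elt sC Cx) (subgroup_elt sC Cy).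
  by move/(congr1 val).
have [y1 y1d y1z] := subgroup_derived sA zA.
have [y2 y2d y2z] := subgroup_derived sB zB.
have zpow (C : set G) (sC : is_subgroup C) (y : subgroup_type sC) x :
    gen_subgroup [set z] (val x) -> val y = z -> gen_subgroup [set y] x.
  move=> xz yz; have [g1 gM gV] := gen_subgroup_group [set y].
  have : [set w | exists2 t, gen_subgroup [set y] t & val t = w] (val x).
    move: xz; apply: gen_subgroup_min => [|_ ->]; last by exists y => //; exact: sub_gen_subgroup.
    split=> [|_ _ [s gs <-] [t gt <-]|_ [s gs <-]]; first by exists 1.
      by exists (s * t) => //; exact: gM.
    by exists s^-1 => //; exact: gV.
  by move=> [t gt /val_inj <-].
have domE x : dom x -> gen_subgroup [set z] (val x).
  by move=> dx; rewrite -ABz; split=> //; exact: subgroup_valP.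
have sub_derived (C : set G) (sC : is_subgroup C) (y x : subgroup_type sC) :
    gen_subgroup [set z] (val x) -> val y = z ->
    derived_subgroup (subgroup_type sC) y -> derived_subgroup (subgroup_type sC) x.
  move=> xz yz dy; have := zpow C sC y x xz yz; apply: gen_subgroup_min => [|_ -> //].
  exact: gen_subgroup_group.
have dy1 : dom y1 by change (B (val y1)); rewrite y1z.
exists G1, G2, phi; split.
- by split; exact: nonab.
- split; last by exists y1 => // y11; apply: z_neq1; rewrite -y1z y11.
  exists y1; apply/seteqP; split=> [x dx|]; first by apply: zpow y1z; exact: domE.
  by apply: gen_subgroup_min => // _ ->.
- by move=> x dx; apply: (sub_derived _ _ y1) => //; exact: domE.
- by move=> _ [x dx <-]; apply: (sub_derived _ _ y2) => //; rewrite mapE//; exact: domE.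
pose q (x : (G1 * G2)%type) := val x.1 * val x.2.
apply: (first_isomorphism (f := q)) => [x y|g|[x y]].
- rewrite /q /= -!mulgA; congr (_ * _); rewrite !mulgA; congr (_ * _).
  exact: (AB (subgroup_valP y.1) (subgroup_valP x.2)).
- have [a [b [Aa Bb ->]]] := GAB g.
  by exists (subgroup_elt sA Aa, subgroup_elt sB Bb).
split=> [[h dh [<- <-]]|]; rewrite /q /=; first by rewrite mapE// mulgV.
move=> xy; have xyE : val x = (val y)^-1 by apply/eqP; rewrite -mulg_eq1; apply/eqP.
have dx : dom x by rewrite /dom /= xyE; apply: (subgroupV sB); exact: subgroup_valP.
by exists x => //; congr (_, _); apply: val_inj; rewrite /= mapE// xyE invgK.
Qed.
End InternalProduct.

(** * Commutator calculus in class two and exponent [p] *)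

Lemma class2_commg_center (G : groupType) (x y : G) :
  nil_class_at_most 2 G -> group_center G [~ x, y].
Proof.
move=> G2 w; apply/commgP/eqP.
have : lower_central G 2 [~ [~ x, y], w].
  apply: sub_gen_subgroup; exists [~ x, y]; last by exists w.
  by apply: sub_gen_subgroup; exists x => //; exists y.
by rewrite [lower_central _ _]G2.
Qed.

Section ClassTwo.
Variable G : groupType.
Hypothesis class2 : forall x y : G, group_center G [~ x, y].

Lemma commg_mull (x y w : G) : [~ x * y, w] = [~ x, w] * [~ y, w].
Proof.
rewrite [LHS]commgEl conjMg invgM -(mulgA y^-1) (mulgA x^-1) -commgEl.
by rewrite (mulgA y^-1) -(class2 x w y^-1) -(mulgA _ y^-1) -commgEl.
Qed.

Lemma commg_invl (x w : G) : [~ x^-1, w] = [~ x, w]^-1.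
Proof. by apply/esym/mulg1_eq; rewrite -commg_mull mulgV comm1g. Qed.

Lemma commg_expl (x w : G) n : [~ x ^+ n, w] = [~ x, w] ^+ n.
Proof.
elim: n => [|n IH]; first exact: comm1g.
by rewrite !expgS commg_mull IH.
Qed.

Lemma commg_expr (w x : G) n : [~ w, x ^+ n] = [~ w, x] ^+ n.
Proof. by rewrite -invgR commg_expl -expVgn invgR. Qed.

Section PrimeExponent.
Variables (p : nat).
Hypotheses (p_prime : prime p) (expp : forall x : G, x ^+ p = 1).

Lemma expg_modp (x : G) n : x ^+ (n %% p) = x ^+ n.
Proof. by rewrite {2}(divn_eq n p) expgnDr mulnC expgnA expp expg1n mul1g. Qed.

Lemma expg_inv_ex (x : G) n : exists m, (x ^+ n)^-1 = x ^+ m.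
Proof.
exists (n * p.-1)%N; apply: mulg1_eq.
by rewrite -expgnDr -mulnS prednK ?prime_gt0// mulnC expgnA expp expg1n.
Qed.

Lemma expg_eq1_dvdn (x : G) n : x <> 1 -> x ^+ n = 1 -> p %| n.
Proof.
move=> x1 xn; apply: contrapT => /negP pn; apply: x1.
have cop : coprime n p by rewrite coprime_sym prime_coprime.
have n0 : 0 < n by rewrite lt0n; apply: contraNneq pn => ->.
have [[u v] /= uv] := coprimeP p n0 cop.
have uE : (u * n = v * p + 1)%N by rewrite -uv subnKC// ltnW// -subn_gt0 uv.
have := congr1 (natexp x) uE; rewrite expgnDr [(u * n)%N]mulnC [(v * p)%N]mulnC !expgnA xn expp.
by rewrite !expg1n mul1g expg1.
Qed.

(** [G] is the central product of the subgroup generated by [a] and [b] and its centraliser [C], and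
    the two meet in the subgroup generated by [z]. *)
Lemma hyperbolic_amalgam (a b : G) : [~ a, b] <> 1 ->
  (forall g, exists i, [~ g, a] = [~ a, b] ^+ i) ->
  (forall g, exists i, [~ g, b] = [~ a, b] ^+ i) ->
  (let C := [set g | commute g a /\ commute g b] in comm_subgroup C C [~ a, b]) ->
  nonabelian_amalgam G.
Proof.
set z := [~ a, b] => z1 ga gb /=; set C := [set g | _] => zC.
have zZ : group_center G z by exact: class2.
pose A : set G := [set g | exists i j k, g = a ^+ i * b ^+ j * z ^+ k].
have zXZ k : group_center G (z ^+ k).
  by move=> w; apply/commute_sym/commuteX/commute_sym/zZ.
have AM x y : A x -> A y -> A (x * y).
  move=> [i [j [k ->]]] [i' [j' [k' ->]]].
  have [m mE] : exists m, [~ b ^+ j, a ^+ i'] = z ^+ m.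
    rewrite commg_expl commg_expr -[[~ b, a]]invgR -/z.
    have [n] := expg_inv_ex z 1; rewrite expg1 => ->.
    by exists (n * (i' * j))%N; rewrite !expgnA.
  exists (i + i')%N, (j + j')%N, (m + k + k')%N.
  rewrite !expgnDr; have aux (x1 x2 y1 y2 u v v' : G) : group_center G u -> group_center G v ->
      x1 * x2 * (y1 * y2) * (u * v * v') = x1 * (x2 * y1 * u) * v * y2 * v'.
    move=> uZ vZ; rewrite -!mulgA; do 3 congr (_ * _).
    by rewrite (mulgA v y2) (vZ y2) -mulgA (mulgA u y2) (uZ y2) -mulgA.
  rewrite aux// -mE -commgC -!mulgA; do 2 congr (_ * _).
  by rewrite !mulgA (zXZ k (a ^+ i')).
have A1 : A 1 by exists 0%N, 0%N, 0%N; rewrite !mulg1.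
have AX x n : A x -> A (x ^+ n).
  by move=> Ax; elim: n => [//|n IH]; rewrite expgS; exact: AM.
have AV x : A x -> A x^-1.
  by have [m] := expg_inv_ex x 1; rewrite expg1 => ->; exact: AX.
have sA : is_subgroup A by [].
have Aa : A a by exists 1%N, 0%N, 0%N; rewrite !mulg1.
have Ab : A b by exists 0%N, 1%N, 0%N; rewrite mul1g mulg1.
have Az : A z by exists 0%N, 0%N, 1%N; rewrite !mul1g.
have sC : is_subgroup C.
  split=> [|x y [xa xb] [ya yb]|x [xa xb]]; split; apply/commute_sym;
    solve [exact: commute1|apply: commuteM; exact: commute_sym|apply: commuteV; exact: commute_sym].
have AC x y : A x -> C y -> commute x y.
  move=> [i [j [k ->]]] [ca cb]; apply/commute_sym; do 2?apply: commuteM.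
  - exact: commuteX.
  - exact: commuteX.
  - exact/commute_sym/zXZ.
apply: (@internal_amalgam G A C sA sC z) => //.
- move=> g; have [i gi] := ga g; have [j gj] := gb g.
  have zb : [~ b, a] = z^-1 by rewrite invgR.
  (* By bilinearity [w] has commutators [z ^- i] with [a] and [z ^- j] with [b], inverse to those of
     [g]. *)
  pose w := b ^+ i * (a ^+ j)^-1.
  have Aw : A w by apply: AM; [exact: AX|exact/AV/AX].
  exists w^-1, (g * w).
  have Cgw : C (g * w).
    split; apply/commgP/eqP; rewrite /w !commg_mull commg_invl !commg_expl ?gi ?gj commgg.
      by rewrite zb expg1n invg1 mulg1 expVgn mulgV.
    by rewrite -/z expg1n mul1g mulgV.
  split=> //; first exact: AV.
  by rewrite (AC w^-1 (g * w))// ?mulgK//; exact: AV.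
- apply/seteqP; split=> [x [[i [j [k xE]]] [xa xb]]|].
    (* The commutator of a^i b^j z^k with [a] is z^-j, and with [b] it is z^i; so both exponents are
       divisible by [p]. *)
    have zj : z ^+ j = 1.
      have /commgP := xa; rewrite xE !commg_mull !commg_expl commgg expg1n mul1g.
      rewrite -[[~ b, a]]invgR expVgn -/z => /eqP.
      have -> : [~ z, a] = 1 by apply/eqP/commgP/zZ.
      by rewrite expg1n mulg1 => /eqP; rewrite invg_eq1 => /eqP.
    have zi : z ^+ i = 1.
      have /commgP := xb; rewrite xE !commg_mull !commg_expl commgg expg1n -/z.
      have -> : [~ z, b] = 1 by apply/eqP/commgP/zZ.
      by rewrite expg1n !mulg1 => /eqP.
    have X1 (y : G) n : z ^+ n = 1 -> y ^+ n = 1.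
      by move=> /(expg_eq1_dvdn z1)/dvdnP[q ->]; rewrite mulnC expgnA expp expg1n.
    rewrite xE (X1 a i zi) (X1 b j zj) !mul1g.
    exact: (subgroupX (gen_subgroup_group _)) (sub_gen_subgroup _).
  apply: gen_subgroup_min => [|_ ->]; last by split=> //; split; exact: zZ.
  by have [C1 CM CV] := sC; split=> [|x y [Ax Cx] [Ay Cy]|x [Ax Cx]]; split;
    [|exact: C1|exact: AM|exact: CM|exact: AV|exact: CV].
by apply: sub_gen_subgroup; exists a => //; exists b.
Qed.
End PrimeExponent.
End ClassTwo.

(** * Coordinates on groups of class two and prime exponent *)

Lemma center_prod (G : groupType) (I : Type) (r : seq I) (f : I -> G) :
  (forall i, group_center G (f i)) -> group_center G (\prod_(i <- r) f i).
Proof.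
move=> fZ; have [Z1 ZM _] := center_is_subgroup G.
elim: r => [|i r IH]; first by rewrite big_nil.
by rewrite big_cons; apply: ZM.
Qed.

Lemma prod_center_mul (G : groupType) (I : Type) (r : seq I) (f h : I -> G) :
  (forall i, group_center G (f i)) ->
  \prod_(i <- r) (f i * h i) = \prod_(i <- r) f i * \prod_(i <- r) h i.
Proof.
move=> fZ; elim: r => [|i r IH]; first by rewrite !big_nil mulg1.
rewrite !big_cons IH -!mulgA; congr (_ * _).
by rewrite !mulgA; congr (_ * _); rewrite (center_prod r fZ).
Qed.

Lemma Fp_expgD (G : groupType) (p : nat) (x : G) (a b : 'F_p) :
  prime p -> (forall y : G, y ^+ p = 1) -> x ^+ (a + b)%R = x ^+ a * x ^+ b.
Proof.
move=> pp expp; rewrite -expgnDr -[RHS](expg_modp expp).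
by congr (x ^+ _); rewrite /= {3}Fp_cast.
Qed.

Section Coordinates.
Variables (G : groupType) (p n : nat) (x : 'I_n -> G).
Hypotheses (p_prime : prime p) (expp : forall y : G, y ^+ p = 1).
Hypothesis class2 : forall y z : G, group_center G [~ y, z].
Local Notation F := 'F_p.
Local Notation V := 'rV[F]_n.
Local Notation M := 'M[F]_n.

Definition mono (a : V) : G := \prod_(i <- enum 'I_n) x i ^+ (a ord0 i).
(** All ordered pairs occur, so the value does not determine [B]; [coordinates] divides out this
    ambiguity. *)
Definition comm_mono (B : M) : G :=
  \prod_(i <- enum 'I_n) \prod_(j <- enum 'I_n) [~ x i, x j] ^+ (B i j).
(** The cost of collection: moving x_j^(b_j) to the left past x_i^(a_i), for j < i, produces
    [x_i, x_j]^(a_i b_j). *)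
Definition collect (a b : V) : M :=
  (\matrix_(i, j) if (j < i)%N then a ord0 i * b ord0 j else 0)%R.

Let FD (y : G) (a b : F) : y ^+ (a + b)%R = y ^+ a * y ^+ b.
Proof. exact: Fp_expgD. Qed.

Let FM (y : G) (a b : F) : y ^+ (a * b)%R = y ^+ a ^+ b.
Proof.
rewrite -expgnA -[RHS](expg_modp expp).
by congr (y ^+ _); rewrite /= {3}Fp_cast.
Qed.

Let centX (y : G) m : group_center G y -> group_center G (y ^+ m).
Proof. by move=> yZ z; apply/commute_sym/commuteX/commute_sym/yZ. Qed.

Lemma comm_mono_center B : group_center G (comm_mono B).
Proof. by apply: center_prod => i; apply: center_prod => j; exact: centX. Qed.

Lemma comm_monoD B B' : comm_mono (B + B')%R = comm_mono B * comm_mono B'.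
Proof.
rewrite -prod_center_mul => [|i]; last by apply: center_prod => j; exact: centX.
apply: eq_bigr => i _; rewrite -prod_center_mul => [|j]; last exact: centX.
by apply: eq_bigr => j _; rewrite mxE FD.
Qed.

Lemma mono_mul a b : mono a * mono b = mono (a + b)%R * comm_mono (collect a b).
Proof.
rewrite /mono /comm_mono.
(* The induction runs over suffixes of the enumeration, of which only the increasing order is
   retained. *)
have : pairwise (fun i j : 'I_n => (i < j)%N) (enum 'I_n).
  rewrite -(pairwise_map val ltn) val_enum_ord.
  by rewrite -sorted_pairwise; [exact: iota_ltn_sorted|exact: ltn_trans].
elim: (enum 'I_n) => [|i r IH]; first by rewrite !big_nil mulg1.
rewrite pairwise_cons => /andP[ir /IH{}IH]; rewrite !big_cons.
set Sa := \prod_(j <- r) x j ^+ a ord0 j; set Sb := \prod_(j <- r) x j ^+ b ord0 j.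
(* Row [i] contributes nothing, because no index of the suffix precedes [i]. *)
have row_i : \prod_(j <- i :: r) [~ x i, x j] ^+ collect a b i j = 1.
  have : all (fun j : 'I_n => (i <= j)%N) (i :: r).
    by rewrite /= leqnn; apply: sub_all ir => j /ltnW.
  elim: (i :: r) => [|j s IHs]; first by rewrite big_nil.
  by rewrite big_cons => /andP[ij /IHs->]; rewrite mxE ltnNge ij expg0 mulg1.
rewrite big_cons in row_i; rewrite row_i mul1g => {row_i}.
have cols s : all (fun k : 'I_n => (i < k)%N) s ->
    \prod_(k <- s) \prod_(j <- i :: r) [~ x k, x j] ^+ collect a b k j =
    \prod_(k <- s) ([~ x k, x i] ^+ (a ord0 k * b ord0 i)%R *
      \prod_(j <- r) [~ x k, x j] ^+ collect a b k j).
  elim: s => [|k s IHs]; first by rewrite !big_nil.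
  rewrite [all _ _]/= => /andP[ik /IHs{}IHs].
  by rewrite !(big_cons _ _ k) IHs big_cons mxE ik.
rewrite (cols r ir) => {cols}.
rewrite prod_center_mul => [|k]; last exact: centX.
(* Column [i] is the cost of moving the power of [x i] to the left past [Sa]. *)
have -> : \prod_(k <- r) [~ x k, x i] ^+ (a ord0 k * b ord0 i)%R = [~ Sa, x i ^+ b ord0 i].
  rewrite /Sa; elim: r {IH ir Sa Sb} => [|k r IH]; first by rewrite !big_nil comm1g.
  by rewrite !big_cons commg_mull// -IH commg_expr// commg_expl// FM.
set D := \prod_(k <- r) \prod_(j <- r) _ in IH *; set E := [~ Sa, _].
have EZ : group_center G E by exact: class2.
have EE : Sa * x i ^+ b ord0 i = x i ^+ b ord0 i * Sa * E by exact: commgC.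
clearbody D E; rewrite mxE FD -!mulgA; congr (_ * _).
rewrite (mulgA Sa) EE -!mulgA; congr (_ * _).
by rewrite (EZ Sb) (EZ D) mulgA IH -mulgA.
Qed.

Lemma mono0 : mono 0%R = 1.
Proof. by rewrite /mono big1_seq// => i _; rewrite mxE. Qed.

Lemma comm_mono0 : comm_mono 0%R = 1.
Proof.
by rewrite /comm_mono big1_seq// => i _; rewrite big1_seq// => j _; rewrite mxE.
Qed.

Lemma collect0r a : collect a 0%R = 0%R.
Proof. by apply/matrixP => i j; rewrite !mxE mulr0 if_same. Qed.

Lemma collect0l b : collect 0%R b = 0%R.
Proof. by apply/matrixP => i j; rewrite !mxE mul0r if_same. Qed.

Lemma mono_delta i : mono (delta_mx ord0 i) = x i.
Proof.
rewrite /mono; have := enum_uniq 'I_n; have : i \in enum 'I_n by rewrite mem_enum.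
elim: (enum 'I_n) => // j r IH; rewrite inE big_cons mxE /=.
have [<- _ /andP[ir _]|ij /= ir /andP[_ /(IH ir)->]] := eqVneq i j.
  rewrite big1_seq => [|k /= kr]; last first.
    by rewrite mxE /= (negPf (memPn ir _ kr)).
  by rewrite mulg1.
by rewrite mul1g.
Qed.

Lemma mono_comm_mul a b B C : mono a * comm_mono B * (mono b * comm_mono C) =
  mono (a + b)%R * comm_mono (collect a b + B + C)%R.
Proof.
rewrite !comm_monoD !mulgA -mono_mul -!mulgA; congr (_ * _).
by rewrite mulgA (comm_mono_center B) -mulgA.
Qed.

Lemma mono_comm_inv a B : exists C,
  (mono a * comm_mono B)^-1 = mono (- a)%R * comm_mono C.
Proof.
exists (- (collect a (- a) + B))%R; apply: mulg1_eq.
by rewrite mono_comm_mul !addrN mono0 comm_mono0 mulg1.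
Qed.

Hypothesis x_gen : gen_subgroup (range x) = [set: G].

Lemma mono_comm_surj g : exists ab : V * M, g = mono ab.1 * comm_mono ab.2.
Proof.
have : [set: G] g by [].
rewrite -x_gen; move: g; apply: gen_subgroup_min.
  split.
  - by exists (0%R, 0%R); rewrite mono0 comm_mono0 mulg1.
  - move=> _ _ [[a B] ->] [[b C] ->].
    by exists ((a + b)%R, (collect a b + B + C)%R); exact: mono_comm_mul.
  - by move=> _ [[a B] ->]; have [C ->] := mono_comm_inv a B; exists ((- a)%R, C).
move=> _ [i _ <-]; exists (delta_mx ord0 i, 0%R).
by rewrite mono_delta comm_mono0 mulg1.
Qed.

(** Cancelling the other factors of [mono a] isolates a power of [x i] whose exponent is invertible
    modulo [p]. *)
Lemma extract_generator (S : set G) i (a : V) : is_subgroup S -> (a ord0 i != 0)%R ->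
  (forall j, j != i -> S (x j)) -> S (mono a) -> S (x i).
Proof.
move=> sS ai Sj Sa.
suff Sxa : S (x i ^+ a ord0 i).
  have -> : x i = x i ^+ a ord0 i ^+ (a ord0 i)^-1%R.
    by rewrite -FM mulfV.
  exact: subgroupX.
move: Sa; rewrite /mono; have := enum_uniq 'I_n; have : i \in enum 'I_n by rewrite mem_enum.
have Sjs r : i \notin r -> S (\prod_(j <- r) x j ^+ a ord0 j).
  elim: r => [|j r IH]; first by rewrite big_nil => _; exact: (subgroup1 sS).
  rewrite inE negb_or big_cons => /andP[ij /IH Sr]; apply: (subgroupM sS) => //.
  by apply: (subgroupX sS); apply: Sj; rewrite eq_sym.
elim: (enum 'I_n) => // j r IH; rewrite inE big_cons /=.
have [<- _ /andP[ir _] Sr|ij /= ir /andP[_ ru] Sr] := eqVneq i j.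
  by rewrite -[x i ^+ _](mulgK (\prod_(j <- r) x j ^+ a ord0 j));
    apply: (subgroupM sS) => //; apply: (subgroupV sS); exact: Sjs.
apply: (IH ir ru); rewrite -[\prod_(k <- r) _](mulKg (x j ^+ a ord0 j)).
apply: (subgroupM sS) => //; apply: (subgroupV sS); apply: (subgroupX sS).
by apply: Sj; rewrite eq_sym.
Qed.
End Coordinates.

(** A relation with a_i nonzero makes [x i] redundant, as [G] has the same commutators as the
    subgroup [S] generated by the other [x j]. *)
Lemma relation_fewer_generators (G : groupType) (p n : nat) (x : 'I_n -> G)
    (a : 'rV['F_p]_n) (B : 'M['F_p]_n) :
  prime p -> (forall y : G, y ^+ p = 1) -> (forall y z : G, group_center G [~ y, z]) ->
  gen_subgroup (range x) = [set: G] ->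
  mono x a * comm_mono x B = 1 -> a != 0%R -> k_generated n.-1 G.
Proof.
case: n x a B => [|n] x a B pp expp class2 xG rel; first by rewrite thinmx0 eqxx.
move=> /eqP a0.
have [i ai] : exists i, (a ord0 i != 0)%R.
  apply: contrapT => h; apply: a0; apply/rowP => i; rewrite mxE.
  by apply/eqP/negPn/negP => ai; apply: h; exists i.
exists (fun j => x (lift i j)); set S := gen_subgroup _.
have sS : is_subgroup S by exact: gen_subgroup_group.
have Sj j : j != i -> S (x j).
  move=> ji; have [k ->] : exists k, j = lift i k.
    by have [|k ->] := @unlift_some _ i j; [rewrite eq_sym|exists k].
  by apply: sub_gen_subgroup; exists k.
have full (T : set G) : is_subgroup T -> S `<=` T -> T (mono x a) -> T = [set: G].
  move=> sT ST Ta; apply/seteqP; split=> // g _; have : [set: G] g by [].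
  rewrite -xG; move: g; apply: gen_subgroup_min => // _ [j _ <-].
  have Tj k : k != i -> T (x k) by move=> ki; apply: ST; exact: Sj.
  have [->|] := eqVneq j i; last exact: Tj.
  exact: (extract_generator pp expp sT ai Tj Ta).
have aB : mono x a = (comm_mono x B)^-1 by apply/eqP; rewrite -mulg_eq1 rel.
have [Z1 ZM ZV] := center_is_subgroup G.
have aZ : group_center G (mono x a) by rewrite aB; apply: ZV; exact: comm_mono_center.
(* The relation makes [mono x a] central, so S Z(G) contains [x i] and is all of [G]. Hence all
   commutators lie in [S], then [mono x a] does, and finally [x i]. *)
pose T : set G := [set g | exists s u, [/\ S s, group_center G u & g = s * u]].
have TG : T = [set: G].
  apply: full.
  - split=> [|_ _ [s [u [Ss uZ ->]]] [t [v [St vZ ->]]]|_ [s [u [Ss uZ ->]]]].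
    + by exists 1, 1; split; rewrite ?mulg1//; exact: (subgroup1 sS).
    + exists (s * t), (u * v); split; [exact: (subgroupM sS)|exact: ZM|].
      by rewrite -!mulgA; congr (_ * _); rewrite !mulgA (uZ t).
    + exists s^-1, u^-1; split; [exact: (subgroupV sS)|exact: ZV|].
      by rewrite invgM (ZV u uZ).
  - by move=> s Ss; exists s, 1; rewrite mulg1.
  - by exists 1, (mono x a); rewrite mul1g; split=> //; exact: (subgroup1 sS).
have Scomm g h : S [~ g, h].
  have : T g by rewrite TG.
  have : T h by rewrite TG.
  move=> [t [v [St vZ ->]]] [s [u [Ss uZ ->]]].
  rewrite commgMcenter// commg_center_mull// /commg /conjg.
  by do ?[apply: (subgroupM sS) || apply: (subgroupV sS)].
apply: full => //; rewrite aB; apply: (subgroupV sS).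
have Sprod (r : seq 'I_n.+1) (f : 'I_n.+1 -> G) : (forall i, S (f i)) -> S (\prod_(i <- r) f i).
  move=> Sf; elim: r => [|j r IH]; first by rewrite big_nil; exact: (subgroup1 sS).
  by rewrite big_cons; exact: (subgroupM sS).
by apply: (Sprod _) => j; apply: (Sprod _) => k; exact: (subgroupX sS).
Qed.

(** Scalars in 'F_p act as natural multiples, so closure under addition suffices. *)
Lemma closed_vspace (p m n : nat) (P : 'M['F_p]_(m, n) -> Prop) :
  P 0%R -> (forall B C, P B -> P C -> P (B + C)%R) ->
  exists U : {vspace 'M['F_p]_(m, n)}, forall B, B \in U <-> P B.
Proof.
move=> P0 PD; pose s := [seq B <- enum [set: 'M['F_p]_(m, n)]%SET | `[< P B >]].
exists <<s>>%VS => B; split=> [Bs|PB]; last first.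
  by apply: memv_span; rewrite mem_filter mem_enum inE andbT; apply/asboolP.
have Pn C k : P C -> P (C *+ k)%R.
  by move=> PC; elim: k => [//|k IH]; rewrite mulrS; exact: PD.
have /coord_span -> : B \in <<in_tuple s>>%VS by [].
apply: (big_ind P) => // i _; rewrite -[coord _ _ _]natr_Zp scaler_nat; apply: Pn.
have : s`_i \in s by apply: mem_nth.
by rewrite mem_filter => /andP[/asboolP].
Qed.

(** The hypothesis on relations makes the exponent vector [v] unique. The matrix is unique up to the
    subspace [U] of matrices with trivial [comm_mono]; [r] projects along [U], so [w] picks a
    canonical representative. *)
Lemma coordinates (G : groupType) (p n : nat) (x : 'I_n -> G) :
  prime p -> (forall y : G, y ^+ p = 1) -> (forall y z : G, group_center G [~ y, z]) ->
  gen_subgroup (range x) = [set: G] ->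
  (forall (a : 'rV['F_p]_n) (B : 'M['F_p]_n), mono x a * comm_mono x B = 1 -> a = 0%R) ->
  exists (v : G -> 'rV['F_p]_n) (w : G -> 'M['F_p]_n) (r : 'M['F_p]_n -> 'M['F_p]_n),
  [/\ linear r, forall g h, v (g * h) = (v g + v h)%R,
      forall g h, w (g * h) = (w g + w h + r (collect (v g) (v h)))%R,
      forall g h, v g = v h -> w g = w h -> g = h
    & forall a, v (mono x a) = a].
Proof.
move=> pp expp class2 xG irr.
have [U UP] : exists U : {vspace 'M['F_p]_n}, forall B, B \in U <-> comm_mono x B = 1.
  apply: closed_vspace; first by rewrite comm_mono0.
  by move=> B C B1 C1; rewrite comm_monoD// B1 C1 mulg1.
have /choice[c cE] := mono_comm_surj pp expp class2 xG.
have uniq_v (a b : 'rV['F_p]_n) (B C : 'M['F_p]_n) :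
    mono x a * comm_mono x B = mono x b * comm_mono x C -> a = b.
  have [D DE] := @mono_comm_inv G p n x pp expp class2 b C.
  move=> /(congr1 ( *%g^~ (mono x b * comm_mono x C)^-1)); rewrite mulgV DE mono_comm_mul//.
  by move=> /irr/eqP; rewrite subr_eq0 => /eqP.
pose r (B : 'M['F_p]_n) := (B - projv U B)%R.
have rl : linear r.
  by move=> k u v; rewrite /r linearP scalerBr opprD addrACA.
have rE (B C : 'M['F_p]_n) : comm_mono x B = comm_mono x C <-> r B = r C.
  have -> : r B = r C <-> (B - C)%R \in U.
    have -> : r B = r C <-> r (B - C)%R = 0%R.
      have -> : (B - C = (-1) *: C + B)%R by rewrite scaleN1r addrC.
      rewrite rl scaleN1r addrC; split=> [->|/eqP]; first by rewrite subrr.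
      by rewrite subr_eq0 => /eqP.
    rewrite /r; split=> [/eqP|/projv_id ->]; last by rewrite subrr.
    by rewrite subr_eq0 => /eqP ->; exact: memv_proj.
  rewrite UP; have -> : comm_mono x B = comm_mono x (B - C)%R * comm_mono x C.
    by rewrite -comm_monoD// subrK.
  by split=> [/(canRL (mulgK _))|->]; rewrite ?mulgV ?mul1g.
exists (fun g => (c g).1), (fun g => r (c g).2), r; split=> //.
- move=> g h; have := cE (g * h); rewrite {1}(cE g) {1}(cE h) mono_comm_mul// => e.
  exact/esym/uniq_v/e.
- move=> g h; have := cE (g * h); rewrite {1}(cE g) {1}(cE h) mono_comm_mul// => e.
  have e1 := uniq_v _ _ _ _ e; move: e; rewrite -e1 => /mulgI/rE <-.
  have rD u u' : r (u + u')%R = (r u + r u')%R by have := rl 1%R u u'; rewrite !scale1r.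
  by rewrite !rD -addrA addrC.
- by move=> g h /= vgh /rE wgh; rewrite (cE g) (cE h) vgh wgh.
move=> a; apply: esym; apply: (uniq_v _ _ 0%R (c (mono x a)).2).
by rewrite -cE comm_mono0 mulg1.
Qed.

Local Close Scope group_scope.
Local Close Scope quotient_scope.

(** * Trilinear forms as coboundaries *)

Section Trilinear.
Local Open Scope ring_scope.
Variables (F : fieldType) (n : nat).
Local Notation V := 'rV[F]_n.

Definition trilinear (m : 'I_n -> 'I_n -> 'I_n -> F) (a b d : V) : F :=
  \sum_i \sum_j \sum_k a ord0 i * b ord0 j * d ord0 k * m i j k.

Lemma trilinearD1 m a a' b d :
  trilinear m (a + a') b d = trilinear m a b d + trilinear m a' b d.
Proof.
rewrite -big_split; apply: eq_bigr => i _; rewrite -big_split; apply: eq_bigr => j _.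
by rewrite -big_split; apply: eq_bigr => k _ /=; rewrite mxE; ring.
Qed.

Lemma trilinearD2 m a b b' d :
  trilinear m a (b + b') d = trilinear m a b d + trilinear m a b' d.
Proof.
rewrite -big_split; apply: eq_bigr => i _; rewrite -big_split; apply: eq_bigr => j _.
by rewrite -big_split; apply: eq_bigr => k _ /=; rewrite mxE; ring.
Qed.

Lemma trilinearD3 m a b d d' :
  trilinear m a b (d + d') = trilinear m a b d + trilinear m a b d'.
Proof.
rewrite -big_split; apply: eq_bigr => i _; rewrite -big_split; apply: eq_bigr => j _.
by rewrite -big_split; apply: eq_bigr => k _ /=; rewrite mxE; ring.
Qed.

Lemma trilinear_sym12 m a b d : (forall i j k, m i j k = m j i k) ->
  trilinear m a b d = trilinear m b a d.
Proof.
move=> mS; rewrite /trilinear exchange_big; apply: eq_bigr => i _.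
by apply: eq_bigr => j _; apply: eq_bigr => k _; rewrite (mS j i) [a _ _ * _]mulrC.
Qed.

Lemma trilinear_sym23 m a b d : (forall i j k, m i j k = m i k j) ->
  trilinear m a b d = trilinear m a d b.
Proof.
move=> mS; apply: eq_bigr => i _; rewrite exchange_big; apply: eq_bigr => j _.
by apply: eq_bigr => k _; rewrite (mS i k j) [_ * b _ _ * _]mulrAC.
Qed.

Lemma trilinear_add m m' a b d :
  trilinear (fun i j k => m i j k + m' i j k) a b d = trilinear m a b d + trilinear m' a b d.
Proof.
rewrite -big_split; apply: eq_bigr => i _; rewrite -big_split; apply: eq_bigr => j _.
by rewrite -big_split; apply: eq_bigr => k _ /=; rewrite mulrDr.
Qed.

Lemma trilinear0 m a b d : a = 0 \/ b = 0 \/ d = 0 -> trilinear m a b d = 0.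
Proof.
move=> h; rewrite /trilinear big1// => i _; rewrite big1// => j _; rewrite big1// => k _.
by case: h => [|[]] ->; rewrite mxE ?(mulr0, mul0r).
Qed.

(* Modulo forms symmetric in two adjacent arguments, a trilinear form is
   alternating, so the Jacobi identity splits the triangular half of [q] into two
   such forms; [u] is the one that is symmetric in the last two arguments. *)
Lemma triangular_coboundary (q : 'I_n -> 'I_n -> 'I_n -> F) :
  2%:R != 0 :> F -> (forall i j k, q j i k = - q i j k) ->
  (forall i j k, q i j k + q j k i + q k i j = 0) ->
  exists g : V -> V -> F,
  [/\ forall b, g 0 b = 0, forall a, g a 0 = 0
    & forall a b d, trilinear (fun i j k => if (j < i)%N then q i j k else 0) a b d =
        g b d - g (a + b) d + g a (b + d) - g a b].
Proof.
move=> two_neq0 qC qJ; set m := fun i j k : 'I_n => if _ then _ else _.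
pose u (i j k : 'I_n) := if (j <= k)%N then m i j k else m i k j.
pose s i j k := m i j k - u i j k.
have uS i j k : u i j k = u i k j.
  by rewrite /u; case: ltngtP => // jk; congr (m i _ _); apply: val_inj.
(* [s i j k] is 0 unless [k < j], where it is [m i j k - m i k j]. Depending on the order of the
   indices, the symmetry is trivial or is the Jacobi identity [q2]. *)
have sS i j k : s i j k = s j i k.
  rewrite /s /u /m.
  have := qJ i j k; rewrite (qC i k j) (qC i j k) => qJ'.
  have q2 : q i j k = q i k j - q j k i by apply: (eq_sub2 qJ' (erefl 0)); ring.
  case: (ltngtP i j) => [ij|ij|/val_inj->] //; case: (leqP j k) => jk; case: (leqP i k) => ik.
  all: try by rewrite q2; ring.
  - by have := ltn_trans (leq_ltn_trans jk ik) ij; rewrite ltnn.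
  - by have := leq_ltn_trans ik (ltn_trans jk ij); rewrite ltnn.
(* The coboundary of u(a, b, b)/2 is u(a, b, d), and that of -s(a, a, b)/2 is s(a, b, d). *)
exists (fun a b => (trilinear u a b b - trilinear s a a b) / 2%:R); split.
- by move=> b; rewrite !trilinear0 ?subrr ?mul0r//; auto.
- by move=> a; rewrite !trilinear0 ?subrr ?mul0r//; auto.
move=> a b d; have -> : trilinear m a b d = trilinear u a b d + trilinear s a b d.
  rewrite -trilinear_add; apply: eq_bigr => i _; apply: eq_bigr => j _.
  by apply: eq_bigr => k _; rewrite /s addrC subrK.
rewrite !(trilinearD1, trilinearD2, trilinearD3).
rewrite (trilinear_sym23 a d b uS) (trilinear_sym12 b a d sS).
by field.
Qed.
End Trilinear.

(** * Cocycles from Jacobi forms *)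

Section JacobiCocycle.
Local Open Scope ring_scope.
Variables (p n : nat) (L : vectType 'F_p) (r : 'M['F_p]_n -> L).
Local Notation F := 'F_p.
Local Notation V := 'rV[F]_n.
Hypotheses (rl : linear r) (two_neq0 : 2%:R != 0 :> F).

(** The commutator form of the group in coordinates: the difference of the costs of the two
    products. *)
Definition collect_comm (a b : V) : L := r (collect a b - collect b a).

Let rN B : r (- B) = - r B.
Proof. by have [f fE] := hom_ex rl; rewrite !fE linearN. Qed.

Lemma collect_commC a b : collect_comm b a = - collect_comm a b.
Proof. by rewrite /collect_comm -rN opprB. Qed.

Lemma collect_comm_alt a : collect_comm a a = 0.
Proof. by rewrite /collect_comm subrr; have [f ->] := hom_ex rl; rewrite linear0. Qed.

Lemma collect_linearl b : linear (fun a => collect a b : 'M[F]_n).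
Proof.
move=> k u v; apply/matrixP => i j; rewrite !mxE; case: ifP => _; first by ring.
by rewrite mulr0 addr0.
Qed.

Lemma collect_linearr a : linear (fun b => collect a b : 'M[F]_n).
Proof.
move=> k u v; apply/matrixP => i j; rewrite !mxE; case: ifP => _; first by ring.
by rewrite mulr0 addr0.
Qed.

Lemma collect_comm_linearl b : linear (collect_comm^~ b).
Proof.
move=> k u v; rewrite /collect_comm -rl; congr r.
by rewrite collect_linearl collect_linearr scalerBr opprD addrACA.
Qed.

Lemma collect_comm_linearr a : linear (collect_comm a).
Proof.
move=> k u v; rewrite /collect_comm -rl; congr r.
by rewrite collect_linearl collect_linearr scalerBr opprD addrACA.
Qed.

(** For j < i the matrix unit at (i, j) is the collection matrix of the commutator of e_i and e_j,
    so the left side is the triangular half of the form with coefficients t([e_i, e_j], e_k). *)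
Lemma jacobi_coboundary (t : L -> V -> F) : jacobi_form collect_comm t ->
  exists g : V -> V -> F,
  [/\ forall b, g 0 b = 0, forall a, g a 0 = 0
    & forall a b d, t (r (collect a b)) d = g b d - g (a + b) d + g a (b + d) - g a b].
Proof.
move=> [tV tL tJ]; pose e i : V := delta_mx ord0 i.
have tC w d : t (- w) d = - t w d.
  by have [f fE] := scalarP_ex (tL d); rewrite !fE linearN.
have [||g [g1 g2 gE]] := @triangular_coboundary F n
    (fun i j k => t (collect_comm (e i) (e j)) (e k)) two_neq0.
- by move=> i j k; rewrite collect_commC tC.
- by move=> i j k; exact: tJ.
exists g; split=> // a b d; rewrite -gE.
have lrt D : scalar (fun B => t (r B) D) by move=> k B C; rewrite rl tL.
rewrite [in LHS](matrix_sum_delta (collect a b)).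
have [f fE] := scalarP_ex (lrt d).
rewrite fE linear_sum; apply: eq_bigr => i _; rewrite linear_sum; apply: eq_bigr => j _.
rewrite linearZ /= -fE.
have [h hE] := scalarP_ex (tV (r (delta_mx i j))).
rewrite hE {1}(row_sum_delta d) linear_sum mulr_sumr; apply: eq_bigr => k _.
rewrite linearZ /= -hE mxE; case: ifP => ji; last by rewrite !(mul0r, mulr0).
suff -> : collect_comm (e i) (e j) = r (delta_mx i j) by rewrite /e; ring.
congr r; apply/matrixP => k' l; rewrite !mxE /=.
have ij : (i == j) = false by apply/eqP => ij; rewrite ij ltnn in ji.
have [->|k'i] := eqVneq k' i; have [->|lj] := eqVneq l j;
  rewrite /= ?ji ?[j == i]eq_sym ?ij ?(mulr0, mul0r, mulr1) ?subr0 ?if_same ?subrr//.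
rewrite sub0r; have [->|] := eqVneq k' j; last by rewrite mul0r if_same oppr0.
have [->|] := eqVneq l i; last by rewrite mulr0 if_same oppr0.
by rewrite ltnNge (ltnW ji) oppr0.
Qed.

(** t(w x, v y) fails to be a cocycle only by t(r(collect(v x, v y)), v k), since [w] is not
    additive; the cochain [g] corrects this defect without affecting the values at [z]. *)
Lemma jacobi_cocycle (G : groupType) (v : G -> V) (w : G -> L) t :
  (forall g h, v (g * h)%g = v g + v h) ->
  (forall g h, w (g * h)%g = w g + w h + r (collect (v g) (v h))) ->
  jacobi_form collect_comm t ->
  exists2 f : G -> G -> F, cocycle f
    & forall z g, v z = 0 -> f z g - f g z = t (w z) (v g).
Proof.
move=> vM wM tj; have [g [g0 g0' gE]] := jacobi_coboundary tj; have [tV tL _] := tj.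
have tD1 u u' d : t (u + u') d = t u d + t u' d.
  by have [f fE] := scalarP_ex (tL d); rewrite !fE linearD.
have tD2 u d d' : t u (d + d') = t u d + t u d'.
  by have [f fE] := scalarP_ex (tV u); rewrite !fE linearD.
have t0r u : t u 0 = 0 by have [f ->] := scalarP_ex (tV u); rewrite linear0.
have t0l d : t 0 d = 0 by have [f ->] := scalarP_ex (tL d); rewrite linear0.
have v1 : v 1%g = 0 by apply: (@addrI _ (v 1%g)); rewrite -vM mulg1 addr0.
have w1 : w 1%g = 0.
  have := wM 1%g 1%g; rewrite mulg1 v1 collect0l.
  have -> : r 0 = 0 by have [f ->] := hom_ex rl; rewrite linear0.
  by rewrite addr0 => e; apply: (@addrI _ (w 1%g)); rewrite -e addr0.
exists (fun x y => t (w x) (v y) + g (v x) (v y)).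
  split=> [x|x|x y k]; rewrite ?v1 ?w1 ?g0 ?g0' ?t0r ?t0l ?addr0//.
  by rewrite !vM !wM !tD1 !tD2 gE; ring.
by move=> z x vz; rewrite vz g0 g0' t0r !addr0 subr0.
Qed.
End JacobiCocycle.

Lemma bilinear_cocycle (G : groupType) (p n : nat) (v : G -> 'rV['F_p]_n) i j :
  (forall g h, v (g * h)%g = v g + v h)%R ->
  cocycle (fun g h => v g ord0 i * v h ord0 j)%R.
Proof.
move=> vM; have v1 : v 1%g = 0%R by apply: (@addrI _ (v 1%g)); rewrite -vM mulg1 addr0.
split=> [g|g|g h k]; rewrite ?v1 ?vM ?mxE ?mul0r ?mulr0//; ring.
Qed.

(** * An element that no cocycle detects yields an amalgam *)

Section CapableOrAmalgam.
Variables (G : groupType) (p n : nat) (x : 'I_n -> G).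
Hypotheses (p_prime : prime p) (p_odd : odd p) (expp : forall y : G, (y ^+ p = 1)%g).
Hypothesis class2 : forall y z : G, group_center G [~ y, z]%g.
Hypothesis x_gen : gen_subgroup (range x) = [set: G].
Hypothesis irr : forall (a : 'rV['F_p]_n) (B : 'M['F_p]_n),
  (mono x a * comm_mono x B = 1)%g -> a = 0%R.
Hypotheses (n_gt1 : (1 < n)%N) (n_le5 : (n <= 5)%N).

Lemma two_Fp_neq0 : (2%:R != 0 :> 'F_p)%R.
Proof.
rewrite -(dvdn_pcharf (pchar_Fp p_prime)) dvdn_prime2//.
by apply: contraTneq p_odd => ->.
Qed.

Lemma capable_or_amalgam : ~ nonabelian_amalgam G -> capable G.
Proof.
move=> noam; apply: (@capable_of_cocycles G 'F_p) => z z1 _.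
apply: contrapT => nof.
have symf (f : G -> G -> 'F_p) g : cocycle f -> f z g = f g z.
  move=> cf; apply: contrapT => fg; apply: nof; exists f => //; by exists g.
have [v [w [r [rl vM wM vw vx]]]] := coordinates p_prime expp class2 x_gen irr.
have v1 : v 1%g = 0%R by apply: (@addrI _ (v 1%g)); rewrite -vM mulg1 addr0.
have r0 : r 0%R = 0%R by have [f ->] := hom_ex rl; rewrite linear0.
have rB B C : r (B - C)%R = (r B - r C)%R by have [f fE] := hom_ex rl; rewrite !fE linearB.
have w1 : w 1%g = 0%R.
  have := wM 1%g 1%g; rewrite mulg1 v1 collect0l r0.
  by rewrite addr0 => e; apply: (@addrI _ (w 1%g)); rewrite -e addr0.
(* The cocycle v_i v_j with j different from i, evaluated at [z] and [x j], is symmetric only if the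
   i-th coordinate of [z] is 0. *)
have vz : v z = 0%R.
  apply/rowP => i; rewrite mxE; have [j ji] : exists j : 'I_n, j != i.
    have n0 : (0 < n)%N by exact: ltnW.
    have [i0|i0] := eqVneq (val i) 0%N; [exists (Ordinal n_gt1)|exists (Ordinal n0)].
      by rewrite -val_eqE /= i0.
    by rewrite -val_eqE /= eq_sym.
  have := symf _ (mono x (delta_mx ord0 j : 'rV['F_p]_n)) (@bilinear_cocycle G p n v i j vM).
  by rewrite /= vx !mxE !eqxx /= (eq_sym i) (negPf ji) mulr1 mul0r.
have zeta_neq0 : (w z != 0)%R.
  by apply/eqP => wz; apply: z1; apply: vw; rewrite ?vz ?v1 ?wz ?w1.
have nocap t : jacobi_form (collect_comm r) t -> forall d, t (w z) d = 0%R.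
  move=> tj d; have [f cf fE] := jacobi_cocycle rl two_Fp_neq0 vM wM tj.
  by have := fE z (mono x d) vz; rewrite vx symf// subrr.
have wcomm g h : v [~ g, h]%g = 0%R /\ w [~ g, h]%g = collect_comm r (v g) (v h).
  move: (commgC g h); move: [~ g, h]%g => k e.
  have vc : v k = 0%R.
    have := congr1 v e; rewrite !vM => e1.
    by apply: (@addrI _ (v h + v g)%R); rewrite -e1 addr0 addrC.
  split=> //; have := congr1 w e; rewrite !wM vc vM collect0r r0 addr0.
  rewrite [(w h + w g)%R]addrC -!addrA => /addrI/addrI e1.
  by rewrite /collect_comm rB e1 addrAC subrr add0r.
have cl a : linear (collect_comm r a) by exact: collect_comm_linearr.
have cr b : linear ((collect_comm r)^~ b) by exact: collect_comm_linearl.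
have ca a : collect_comm r a a = 0%R by exact: collect_comm_alt.
have dV : \dim {:'rV['F_p]_n} = n by rewrite dimvf /dim /= mul1n.
have [||a [b [ab aV bV zC]]] :=
  hyperbolic_pair cl cr ca zeta_neq0 two_Fp_neq0 _ nocap.
- by rewrite dV.
- by rewrite dV ltnW.
pose ga := mono x a; pose gb := mono x b.
have comm_eq g h k : v k = 0%R -> collect_comm r (v g) (v h) = w k -> [~ g, h]%g = k.
  by move=> vk ck; have [vc wc] := wcomm g h; apply: vw; rewrite ?vc ?wc.
have gab : [~ ga, gb]%g = z by apply: comm_eq => //; rewrite !vx.
have wX k m : v k = 0%R -> v (k ^+ m)%g = 0%R /\ w (k ^+ m)%g = (w k *+ m)%R.
  move=> vk; elim: m => [|m [IHv IHw]]; first by rewrite v1 w1.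
  by rewrite expgS vM wM vk IHv IHw collect0l r0 !addr0 mulrS.
have zpow g a' : (forall u, collect_comm r a' u \in <[w z]>%VS) ->
    exists i, [~ g, mono x a']%g = (z ^+ i)%g.
  move=> a'V; have : collect_comm r (v g) a' \in <[w z]>%VS.
    by rewrite (collect_commC rl) rpredN.
  move=> /vlineP[k kE]; exists k; have [vzk wzk] := wX z k vz.
  by apply: comm_eq => //; rewrite vx wzk kE -{1}[k]natr_Zp scaler_nat.
apply: noam; apply: (hyperbolic_amalgam class2 p_prime expp (a := ga) (b := gb)); rewrite gab //.
- by move=> g; exact: zpow.
- by move=> g; exact: zpow.
move=> C; have [C1 CM _] := gen_subgroup_group [set [~ s, t]%g | s in C & t in C].
(* [U] is the [w]-image of the elements of [C, C] with trivial [v]; the last clause of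
   [hyperbolic_pair] puts [w z] into it. *)
have [||U UP] := @closed_vspace p n n
    (fun B => exists g, [/\ comm_subgroup C C g, v g = 0%R & w g = B]).
- by exists 1%g.
- move=> _ _ [g [Cg vg <-]] [h [Ch vh <-]]; exists (g * h)%g.
  by split; [exact: CM|rewrite vM vg vh addr0|rewrite wM vg collect0l r0 addr0].
have Cmono u : collect_comm r a u = 0%R -> collect_comm r b u = 0%R -> C (mono x u).
  move=> au bu; split; apply/commgP/eqP; apply: comm_eq;
    by rewrite ?v1 // w1 !vx (collect_commC rl) ?au ?bu oppr0.
have /UP[g [Cg vg wg]] : w z \in U.
  apply: zC => u u' au bu au' bu'; apply/UP; exists [~ mono x u, mono x u']%g.
  have [vc wc] := wcomm (mono x u) (mono x u'); split=> //; last by rewrite wc !vx.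
  by apply: sub_gen_subgroup; exists (mono x u); [exact: Cmono|exists (mono x u'); [exact: Cmono|]].
by rewrite (vw z g) ?vg.
Qed.
End CapableOrAmalgam.

(** * The trichotomy, by way of a generating family of minimal length *)

Theorem theorem7p3 (p : nat) (G : groupType)
  (p_prime : prime p) (p_odd : odd p)
  (G_gen : k_generated 5 G)
  (G_class : nil_class_at_most 2 G)
  (G_exp : forall x : G, (x ^+ p)%g = 1%g) :
  exactly_one3 (nontrivial_cyclic G) (nonabelian_amalgam G) (capable G).
Proof.
have am_not_capable : nonabelian_amalgam G -> ~ capable G.
  by move=> [G1 [G2 [phi [_ [_ d1] d2 d3 iso]]]]; exact: amalgam_not_capable iso.
have [cyc|ncyc] := EM (nontrivial_cyclic G).
  constructor 1; split=> //; last exact: cyclic_not_capable.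
  move=> [G1 [G2 [phi [[ab1 _] _ _ _ iso]]]].
  by apply: (amalgam_not_abelian ab1 iso); apply: cyclic_abelian; case: cyc.
have [am|nam] := EM (nonabelian_amalgam G).
  by constructor 2; split=> //; exact: am_not_capable.
constructor 3; split=> //.
have exn : exists n, `[< k_generated n G >] by exists 5; apply/asboolP.
have [n /asboolP[x xG] nmin] := ex_minnP exn.
have n5 : (n <= 5)%N by apply: nmin; apply/asboolP.
have class2 (y z : G) : group_center G [~ y, z]%g by exact: class2_commg_center.
(* By minimality of [n]; for [n = 0], where [n.-1 = n], there is no nonzero [a]. *)
have irr (a : 'rV['F_p]_n) (B : 'M['F_p]_n) : (mono x a * comm_mono x B = 1)%g -> a = 0%R.
  move=> rel; apply/eqP/negPn/negP => a0.
  have /asboolP/nmin := relation_fewer_generators p_prime G_exp class2 xG rel a0.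
  case: n {x xG nmin n5} a a0 {B rel} => [|n] a a0; first by rewrite thinmx0 eqxx in a0.
  by rewrite ltnn.
have [n1|n1] := ltnP 1 n; first exact: (capable_or_amalgam p_prime p_odd G_exp class2 xG irr).
have Gcyc : cyclic_subgroup [set: G].
  case: n x xG {nmin n5 irr} n1 => [|[|//]] x xG _.
    exists 1%g; rewrite -xG; apply/seteqP; split; apply: gen_subgroup_min;
      try exact: gen_subgroup_group; first by move=> t [[]].
    by move=> _ ->; exact: (subgroup1 (gen_subgroup_group _)).
  exists (x ord0); rewrite -xG; congr gen_subgroup; apply/seteqP; split=> [_ [i _ <-]|_ ->].
    by rewrite (ord1 i).
  by exists ord0.
(* [G] is cyclic but not nontrivial cyclic, so there is no [z] other than 1 to detect. *)
apply: (@capable_of_cocycles G 'F_p) => z z1; case: ncyc; split=> //; exists z => //.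
Qed.
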